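(* Let $\tau\in(0,\infty]$, let $\mathcal{A}$ be a finite alphabet, and let $Z\subset\mathcal{A}^{\mathbb{N}_0}$ be a subshift. Then there exists a one-sided subshift $(X,f)$ (over some finite alphabet) satisfying the non-uniform periodic $\tau$-specification property with gap function $M(n,\varepsilon)$ such that: (1) for all sufficiently small $\varepsilon>0$, $\lim_{n\to\infty}\frac{M(n,\varepsilon)}{n}=\tau$; (2) $Z\subset X$; (3) $\mathcal{M}_f^{erg}(X)$ can be written as $\mathcal{M}_f^{erg}(X)=\mathcal{M}_0\cup\mathcal{M}_f^{erg}(Z)$ with $\overline{\mathcal{M}_0}\cap\overline{\mathcal{M}_f^{erg}(Z)}=\varnothing$; (4) for every $x\in X\setminus\bigcup_{i\ge0}f^{-i}Z$ one has $V_f(x)\cap\overline{\mathcal{M}_0}\ne\varnothing$; (5) if $0<\tau<\infty$, then $(X,f)$ can be constructed so that for every $\mu\in\overline{\mathcal{M}_0}$, $$h_\mu(f)\le\log2+\frac{1}{1+\tau}\log|\mathcal{A}|;$$ if $\tau=\infty$, then for every $\delta>0$, $(X,f)$ can be constructed so that for every $\mu\in\overline{\mathcal{M}_0}$, $$h_\mu(f)\le\log2+\delta\log|\mathcal{A}|.$$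
   Context: A topological dynamical system $(X,f)$ consists of a compact metric space $(X,d)$ with at least two points and a continuous map $f:X\to X$; $\mathbb{N}$ is the set of positive integers and $\mathbb{N}_0$ the set of non-negative integers. For a finite alphabet $\mathcal{B}$, $\mathcal{B}^{\mathbb{N}_0}$ carries the shift map $f(x_0x_1x_2\cdots)=x_1x_2\cdots$ and the metric $d(x,y)=\sum_{k\ge0}2^{-k}d'(x_k,y_k)$, $d'$ the discrete metric on $\mathcal{B}$. A (one-sided) subshift is a non-empty closed $f$-invariant subset of $\mathcal{B}^{\mathbb{N}_0}$ with the restricted shift. $\mathcal{M}_f(X)$, $\mathcal{M}_f^{erg}(X)$ are the invariant, resp. ergodic, Borel probability measures, with the weak$^*$ topology (closures are taken in it); measures on $Z\subset X$ are regarded as measures on $X$. $h_\mu(f)$ is measure-theoretic entropy. $V_f(x)$ is the set of weak$^*$ accumulation points of $\delta_x^n=\frac1n\sum_{k=0}^{n-1}\delta_{f^kx}$, $n\ge1$. Non-uniform periodic specification: $(X,f)$ has the non-uniform periodic specification property with gap function $M:\mathbb{N}\times(0,\infty)\to\mathbb{N}$ if $M(n,\varepsilon)$ is non-decreasing in $n$ and non-increasing in $\varepsilon$, and for every $\varepsilon>0$, every integer $k\ge2$, all $x_1,\dots,x_k\in X$ and all non-negative integers $a_1\le b_1<a_2\le b_2<\cdots<a_k\le b_k$ with $a_{i+1}-b_i\ge M(b_i-a_i+1,\varepsilon)$ for $1\le i\le k-1$: there is $z\in X$ with $d(f^{n-a_i}x_i,f^nz)\le\varepsilon$ for all $a_i\le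 n\le b_i$, $1\le i\le k$; and moreover for every positive integer $p\ge b_k-a_1+M(b_k-a_k+1,\varepsilon)$ such a $z$ can be chosen with $f^pz=z$. Let $\mathscr{G}(X,f)$ be the set of all gap functions with which $(X,f)$ has the non-uniform periodic specification property, and $\tau(M)=\sup_{\varepsilon>0}\liminf_{n\to\infty}M(n,\varepsilon)/n\in[0,\infty]$. $(X,f)$ has the non-uniform periodic $\tau$-specification property if there is $M\in\mathscr{G}(X,f)$ with $\tau(M)=\tau$ and every $M'\in\mathscr{G}(X,f)$ satisfies $\tau(M')\ge\tau$; ''with gap function $M$'' means $M\in\mathscr{G}(X,f)$. *)

(* Defs.v *)
From HB Require Import structures.
From mathcomp Require Import all_boot all_order all_algebra.
From mathcomp Require Import all_classical all_reals all_analysis.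

Set Implicit Arguments.
Unset Strict Implicit.
Unset Printing Implicit Defensive.

Import Order.TTheory GRing.Theory Num.Theory.
Import numFieldNormedType.Exports.

Local Open Scope classical_set_scope.
Local Open Scope ring_scope.

(* Non-empty finite alphabets; the point is required by [measurableType]. *)
#[short(type="alphabetType")]
HB.structure Definition Alphabet := {B of Finite B & Pointed B}.

Definition fullshift (R : realType) (B : finType) : Type := nat -> B.

Section fullshift.
Context {R : realType}.

Definition shift_map (B : finType) (x : fullshift R B) : fullshift R B :=
  fun k => x k.+1.

Definition recode (A B : finType) (iota : A -> B) (x : fullshift R A) :
  fullshift R B := fun k => iota (x k).

Section metric.
Variable B : finType.
Implicit Types x y z : fullshift R B.

Definition shift_dist x y : R :=
  limn (series (fun k => 2 ^- k * (x k != y k)%:R : R)).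

Local Definition term x y : R^nat := fun k => 2 ^- k * (x k != y k)%:R.

Local Lemma pow_ge0 k : 0 <= 2 ^- k :> R.
Proof. by rewrite invr_ge0 exprn_ge0. Qed.

Local Lemma term_ge0 x y k : 0 <= term x y k.
Proof. by rewrite mulr_ge0. Qed.

Local Lemma is_cvg_term x y : cvgn (series (term x y)).
Proof.
apply: (@series_le_cvg _ _ (geometric 1 2^-1)).
- exact: term_ge0.
- by move=> k; rewrite /geometric/= mul1r exprVn.
- move=> k; rewrite /geometric/= mul1r exprVn ler_piMr//.
  by case: (_ == _).
- by apply: is_cvg_geometric_series; rewrite ger0_norm ?invf_lt1 ?ltr1n.
Qed.

Local Lemma shift_distxx x : shift_dist x x = 0.
Proof.
rewrite /shift_dist (_ : series _ = cst 0) ?lim_cst//.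
by apply/funext => n; rewrite /series/= big1// => k _; rewrite eqxx mulr0.
Qed.

Local Lemma shift_dist_positivity x y : shift_dist x y = 0 -> x = y.
Proof.
move=> xy0; apply/funext => k; apply/eqP; apply: contraT => xyk.
suff : 2 ^- k <= shift_dist x y.
  by rewrite xy0 leNgt invr_gt0 exprn_gt0.
have -> : 2 ^- k = term x y k by rewrite /term xyk mulr1.
apply: (@le_trans _ _ (series (term x y) k.+1)).
  rewrite /series/= big_nat_recr//= lerDr.
  by apply: sumr_ge0 => i _; exact: term_ge0.
apply: (nondecreasing_cvgn_le _ (@is_cvg_term x y)).
apply/nondecreasing_seqP => n; rewrite /series/= big_nat_recr//= lerDl.
exact: term_ge0.
Qed.

Local Lemma shift_dist_sym x y : shift_dist x y = shift_dist y x.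
Proof.
rewrite /shift_dist; congr (limn (series _)).
by apply/funext => k; rewrite eq_sym.
Qed.

Local Lemma shift_dist_triangle y x z :
  shift_dist x z <= shift_dist x y + shift_dist y z.
Proof.
rewrite /shift_dist -limD; [|exact: is_cvg_term|exact: is_cvg_term].
apply: ler_lim; first exact: is_cvg_term.
  by apply: is_cvgD; exact: is_cvg_term.
apply: nearW => n; rewrite fctE /series/= -big_split/=; apply: ler_sum => k _.
rewrite -mulrDr ler_wpM2l//.
have [->|xy] := eqVneq (x k) (y k); first by rewrite add0r.
by case: (_ == _); case: (_ == _); rewrite -?natrD ler_nat.
Qed.

HB.instance Definition _ := gen_eqMixin (fullshift R B).
HB.instance Definition _ := gen_choiceMixin (fullshift R B).
HB.instance Definition _ := isMetric.Build R (fullshift R B)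
  shift_distxx shift_dist_positivity shift_dist_sym shift_dist_triangle.

End metric.

HB.instance Definition _ (B : alphabetType) :=
  isPointed.Build (fullshift R B) (fun=> point).

(* [shift @` X `<=` X], not equality: X need not be shift-surjective. *)
Definition subshift (B : finType) (X : set (fullshift R B)) :=
  [/\ X !=set0, closed X & @shift_map B @` X `<=` X].

End fullshift.

(* A subsystem of an ambient metric space: X is a subset invariant under f. *)
Section dynamics.
Context {R : realType} {T : metricType R}.
Variables (X : set T) (f : T -> T).

Definition dynamical_system :=
  [/\ compact X, {within X, continuous f}, f @` X `<=` X
    & exists x y, [/\ X x, X y & x <> y]].

(* z shadows the orbit segments x_i, ..., f^(b_i - a_i) x_i placed at times
   a_i, ..., b_i, for i < k. *)
Definition shadows (e : R) (k : nat) (x : nat -> T) (a b : nat -> nat) (z : T) :=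
  forall i n, (i < k)%N -> (a i <= n <= b i)%N ->
    mdist (iter (n - a i) f (x i)) (iter n f z) <= e.

(* Only the values M n e with 0 < n and 0 < e are meaningful.  The k >= 2
   segments are indexed by 0, ..., k.-1. *)
Definition gap_function (M : nat -> R -> nat) :=
  [/\ forall n e, (0 < n)%N -> 0 < e -> (0 < M n e)%N,
      forall m n e, (0 < m)%N -> (m <= n)%N -> 0 < e -> (M m e <= M n e)%N,
      forall n e e', (0 < n)%N -> 0 < e -> e <= e' -> (M n e' <= M n e)%N &
      forall (e : R) (k : nat) (x : nat -> T) (a b : nat -> nat),
        0 < e -> (2 <= k)%N ->
        (forall i, (i < k)%N -> X (x i)) ->
        (forall i, (i < k)%N -> (a i <= b i)%N) ->
        (forall i, (i.+1 < k)%N -> (b i < a i.+1)%N) ->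
        (forall i, (i.+1 < k)%N -> (M (b i - a i).+1 e <= a i.+1 - b i)%N) ->
        (exists2 z, X z & shadows e k x a b z) /\
        (forall p, (0 < p)%N ->
          (b k.-1 - a 0 + M (b k.-1 - a k.-1).+1 e <= p)%N ->
          exists z, [/\ X z, shadows e k x a b z & iter p f z = z])].

Definition gap_rate (M : nat -> R -> nat) : \bar R :=
  ereal_sup [set limn_einf (fun n => ((M n e)%:R / n%:R)%:E)
            | e in [set e : R | 0 < e]].

Definition periodic_specification (tau : \bar R) :=
  (exists2 M, gap_function M & gap_rate M = tau) /\
  (forall M, gap_function M -> (tau <= gap_rate M)%E).

End dynamics.

Section measures.
Variables (R : realType) (T : ptopologicalType).

Definition borel := g_sigma_algebraType (@open T).

(* The coarsest topology making mu |-> \int phi dmu continuous for every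
   continuous phi; this is the weak-star topology when T is compact. *)
Definition weak_star : topologicalType :=
  initial_topology (fun mu : probability borel R =>
    (fun phi : continuousType T R => \int[mu]_x phi x)
      : prod_topology (fun _ : continuousType T R => R)).

Variable f : T -> T.

Definition empirical (x : T) (n : nat) : set borel -> \bar R :=
  mscale (n.+1%:R^-1)%:nng (msum (fun k => \d_(iter k f x : borel)) n.+1).

HB.instance Definition _ x n := Measure.on (empirical x n).

Local Lemma empiricalT x n : empirical x n setT = 1%E.
Proof.
rewrite /empirical /mscale/= /msum (eq_bigr (fun=> 1%:E)) => [|k _].
  by rewrite sumEFin -EFinM sumr_const card_ord mulVf// pnatr_eq0.
exact: diracT.
Qed.

HB.instance Definition _ x n :=
  Measure_isProbability.Build _ _ _ (empirical x n) (empiricalT x n).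

(* [empirical x n] is the average over the first n.+1 points of the orbit. *)
Definition limit_measures (x : T) : set weak_star :=
  cluster ((fun n => empirical x n : weak_star) @ \oo).

(* Ergodic measures of (X, f), as measures on T giving full mass to X. *)
Definition ergodic_measures (X : set T) : set weak_star :=
  [set mu : probability borel R |
    [/\ mu X = 1%E,
        forall E : set borel, measurable E -> mu (f @^-1` E) = mu E &
        forall E : set borel, measurable E -> f @^-1` E = E ->
          mu E = 0%E \/ mu E = 1%E]].

Definition cylinder (k : nat) (xi : T -> 'I_k) (n : nat)
  (w : {ffun 'I_n -> 'I_k}) : set borel :=
  [set x | forall i : 'I_n, xi (iter i f x) = w i].

(* Shannon entropy of the join of xi, ..., f^-(n-1) xi, where the labelling xi
   stands for the partition into its fibres; note ln 0 = 0. *)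
Definition partition_entropy (mu : probability borel R) (k : nat)
    (xi : T -> 'I_k) (n : nat) : R :=
  - \sum_(w : {ffun 'I_n -> 'I_k})
      fine (mu (cylinder xi w)) * ln (fine (mu (cylinder xi w))).

(* For invariant mu the limit exists by subadditivity. *)
Definition entropy (mu : probability borel R) : \bar R :=
  ereal_sup [set h : \bar R | exists (k : nat) (xi : T -> 'I_k),
    (forall j : 'I_k, measurable (xi @^-1` [set j] : set borel)) /\
    h = (limn (fun n => partition_entropy mu xi n / n%:R))%:E].

End measures.

(* Main.v *)
Require Import Defs.
From HB Require Import structures.
From mathcomp Require Import all_boot all_order all_algebra.
From mathcomp Require Import all_classical all_reals all_analysis.
From mathcomp Require Import zify lra.
Import Order.TTheory GRing.Theory Num.Theory.
Import numFieldNormedType.Exports.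
Local Open Scope classical_set_scope.
Local Open Scope ring_scope.

(** Add a star [None] to the alphabet of Z, and let X consist of the sequences
    whose blocks of letters are words of Z, a block of length n that is
    followed by a star being followed by at least g n stars, where g n / n
    tends to tau. Words followed by that many stars can be concatenated and
    repeated freely, which is the specification property; conversely a block of
    length n cannot be followed by a letter beyond a star any sooner, which
    bounds every gap function below by g. An ergodic measure on X that is not
    carried by Z gives letters mass at most 1 / (1 + t) when t n <= g n: weight
    the letters by t and the stars by -1 and compare along the orbits with a
    bounded coboundary. This closed condition separates the two families of
    measures, and it bounds the entropy through Gibbs' inequality for the code
    that spends log 2 on every symbol and log #|A| more on every letter. If x
    in X has infinitely many stars, prefixes of x cut after a completed run of
    stars can be repeated periodically inside X, and the periodic orbit
    measures have the same limits as the empirical measures of x; limits exist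
    by an ultrafilter and Caratheodory's extension theorem. *)

Set Implicit Arguments.
Unset Strict Implicit.
Unset Printing Implicit Defensive.

(** * The topology of the full shift *)

Section shift_topology.
Context {R : realType} (B : finType).
Implicit Types x y z : fullshift R B.

Definition agree (m : nat) x y := forall k, (k < m)%N -> x k = y k.

Lemma agree_sym m x y : agree m x y -> agree m y x.
Proof. by move=> h k km; rewrite h. Qed.

Lemma agree_trans m x y z : agree m x y -> agree m y z -> agree m x z.
Proof. by move=> h h' k km; rewrite h// h'. Qed.

Lemma agree_le m n x y : (m <= n)%N -> agree n x y -> agree m x y.
Proof. by move=> mn h k km; apply: h; exact: leq_trans mn. Qed.

Let term x y : R^nat := fun k => 2 ^- k * (x k != y k)%:R.

Let term_ge0 x y k : 0 <= term x y k.
Proof. by rewrite mulr_ge0// invr_ge0 exprn_ge0. Qed.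

Let term_nd x y : nondecreasing_seq (series (term x y)).
Proof.
by apply/nondecreasing_seqP => n; rewrite /series/= big_nat_recr//= lerDl.
Qed.

(** The terms before m vanish and the geometric tail from m to n telescopes; [maxn] covers partial
    sums that stop before m. *)
Let term_le x y m n : agree m x y ->
  series (term x y) n <= 2 * (2 ^- m - 2 ^- (maxn m n)).
Proof.
move=> xy; elim: n => [|n ih].
  by rewrite /series/= big_geq// maxn0 subrr mulr0.
rewrite /series/= big_nat_recr//= -/(series _ n).
have [nm|mn] := ltnP n m.
  rewrite (maxn_idPl nm) (maxn_idPl (ltnW nm)) in ih *.
  by rewrite /term xy// eqxx mulr0 addr0.
rewrite (maxn_idPr mn) in ih; rewrite (maxn_idPr (leqW mn)).
apply: (le_trans (lerD ih (_ : _ <= 2 ^- n))).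
  by rewrite /term ler_piMr ?invr_ge0 ?exprn_ge0//; case: (_ == _).
by rewrite exprS invfM; lra.
Qed.

Lemma is_cvg_shift_dist x y :
  cvgn (series (fun k => 2 ^- k * (x k != y k)%:R : R)).
Proof.
apply: nondecreasing_is_cvgn; first exact: term_nd.
exists 2 => _ [n _ <-]; apply: le_trans (@term_le x y 0 n _) _ => //.
by have : 0 <= 2 ^- maxn 0 n :> R by []; rewrite expr0 invr1; lra.
Qed.

Lemma agree_mdist m x y : agree m x y -> mdist x y <= 2 * 2 ^- m.
Proof.
move=> xy; apply: limr_le; first exact: is_cvg_shift_dist.
apply: nearW => n; apply: le_trans (term_le _ xy) _.
by have : 0 <= 2 ^- maxn m n :> R by []; lra.
Qed.

Lemma mdist_agree m x y : mdist x y < 2 ^- m -> agree m.+1 x y.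
Proof.
move=> xy k km; apply/eqP; apply: contraTT xy => xyk; rewrite -leNgt.
apply: (@le_trans _ _ (2 ^- k)).
  by rewrite lef_pV2 ?posrE ?exprn_gt0// ler_eXn2l// ltr1n.
apply: (@le_trans _ _ (series (term x y) k.+1)).
  rewrite /series/= big_nat_recr//= {2}/term xyk mulr1 lerDr.
  by apply: sumr_ge0 => i _.
by apply: nondecreasing_cvgn_le => //; exact: is_cvg_shift_dist.
Qed.

Lemma ltr_exp2_ex (e : R) : 0 < e -> exists m, 2 * 2 ^- m < e.
Proof.
move=> e0; exists (Num.bound (2 / e)).
rewrite ltr_pdivrMr ?exprn_gt0// mulrC -ltr_pdivrMr//.
apply: lt_le_trans (archi_boundP _) _; first by rewrite divr_ge0// ltW.
by rewrite -natrX ler_nat ltnW// ltn_expl.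
Qed.

(** Through this, topological statements about the full shift reduce to agreement on finitely many
    coordinates. *)
Lemma nbhs_agreeP x (U : set (fullshift R B)) :
  nbhs x U <-> exists m, forall y, agree m x y -> U y.
Proof.
rewrite -nbhs_ballE; split.
  move=> [e /= e0 eU]; have [m me] := ltr_exp2_ex e0.
  exists m => y xy; apply: eU; rewrite ballEmdist/=.
  exact: le_lt_trans (agree_mdist xy) me.
move=> [m mU]; exists (2 ^- m) => /=; first by rewrite invr_gt0 exprn_gt0.
move=> y; rewrite ballEmdist/= => /mdist_agree xy.
by apply: mU; apply: agree_le xy.
Qed.

Lemma open_agreeP (U : set (fullshift R B)) :
  open U <-> forall x, U x -> exists m, forall y, agree m x y -> U y.
Proof.
rewrite openE; split=> [h x /h|h x /h]; first by move=> /nbhs_agreeP.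
by move=> ?; apply/nbhs_agreeP.
Qed.

Lemma closed_agreeP (X : set (fullshift R B)) :
  closed X <-> forall x, (forall m, exists2 y, X y & agree m x y) -> X x.
Proof.
split=> [cX x xX|h x xX].
  apply: cX => U /nbhs_agreeP[m mU]; have [y Xy xy] := xX m.
  by exists y; split => //; exact: mU.
apply: h => m; have [|y [Xy xy]] := xX [set y | agree m x y].
  by apply/nbhs_agreeP; exists m.
by exists y.
Qed.

(** As the alphabet is finite, an ultrafilter selects one letter in each coordinate; the point made
    of the selected letters is its limit. *)
Lemma fullshift_compact : compact [set: fullshift R B].
Proof.
rewrite compact_ultra => F FU _.
have h k : exists b, F [set x : fullshift R B | x k = b].
  apply: contrapT => /forallNP nF.
  suff : F set0 by exact: filter_not_empty.
  have : \forall x \near F, forall b : B, x k <> b.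
    apply: (@filter_forall _ B (fun b x => x k <> b)) => b; have := nF b.
    by have [] := in_ultra_setVsetC [set x : fullshift R B | x k = b] FU.
  by apply: filterS => x /(_ (x k)).
exists (fun k => projT1 (cid (h k))); split => // U /nbhs_agreeP[m mU].
suff : F [set y | agree m (fun k => projT1 (cid (h k))) y].
  by apply: filterS => y; exact: mU.
elim: m {mU} => [|m ih]; first by apply: filterS (@filterT _ F _) => y _ k.
have Fm : F [set y | y m = projT1 (cid (h m))] by exact: (projT2 (cid (h m))).
apply: filterS (filterI ih Fm) => y [ym ymm] k.
by rewrite ltnS leq_eqVlt => /predU1P[->//|]; exact: ym.
Qed.

Lemma iter_shift_mapE n x k : iter n (@shift_map R B) x k = x (n + k)%N.
Proof.
elim: n k => // n ih k; rewrite iterS /shift_map ih.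
by rewrite addnS.
Qed.

Lemma agree_shift_map m x y :
  agree m.+1 x y -> agree m (@shift_map R B x) (@shift_map R B y).
Proof. by move=> xy k km; apply: xy. Qed.

Lemma shift_map_continuous : continuous (@shift_map R B).
Proof.
move=> x U /nbhs_agreeP[m mU]; apply/nbhs_agreeP; exists m.+1 => y xy.
by apply: mU; exact: agree_shift_map.
Qed.

Lemma closed_compact (X : set (fullshift R B)) : closed X -> compact X.
Proof.
by move=> cX; apply: subclosed_compact cX fullshift_compact _ => x.
Qed.

End shift_topology.

(** * The gap shift *)

Section gap_shift.
Context {R : realType} (A : finType) (Z : set (fullshift R A)) (g : nat -> nat).
Hypotheses (subZ : subshift Z) (g_nd : {homo g : m n / (m <= n)%N}).
Hypothesis (g_gt0 : forall n, (0 < n)%N -> (0 < g n)%N).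
Implicit Types x y : fullshift R (option A).

Local Notation f := (@shift_map R (option A)).
Local Notation ZB := (recode Some @` Z).

Definition block x i n := forall k, (k < n)%N -> x (i + k)%N <> None.

(** The block may start inside a longer run of letters; for monotone [g] the whole run imposes the
    strongest gap. Words of Z can be read off as prefixes of points of Z because Z is
    shift-invariant. *)
Definition admissible x i n := block x i n ->
  (exists2 z, Z z & forall k, (k < n)%N -> x (i + k)%N = Some (z k)) /\
  ((0 < n)%N -> x (i + n)%N = None ->
   forall j, (j < g n)%N -> x (i + n + j)%N = None).

Definition gap_shift := [set x | forall i n, admissible x i n].

Lemma subset_gap_shift : ZB `<=` gap_shift.
Proof.
move=> _ [z Zz <-] i n _; split=> //.
exists (iter i (@shift_map R A) z).
  elim: i => // i ih; rewrite iterS.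
  by have [_ _] := subZ; apply; exists (iter i (@shift_map R A) z).
by move=> k kn; rewrite iter_shift_mapE.
Qed.

Lemma gap_shift_shift x i : gap_shift x -> gap_shift (iter i f x).
Proof.
move=> Xx j n b.
have [|[z Zz zx] h] := Xx (i + j)%N n.
  by move=> k kn; have := b _ kn; rewrite iter_shift_mapE addnA.
split=> [|n0]; first by exists z => // k kn; rewrite iter_shift_mapE addnA zx.
rewrite !iter_shift_mapE addnA => xin l /(h n0 xin) <-.
by rewrite iter_shift_mapE; congr (x _); lia.
Qed.

(** The condition [admissible x i n] inspects only coordinates up to i + n + g n, so it passes to
    limits. *)
Lemma closed_gap_shift : closed gap_shift.
Proof.
apply/closed_agreeP => x h i n b.
have [y Xy xy] := h (i + n + g n).+1.
have [|[z Zz zx] hy] := Xy i n.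
  by move=> k kn; rewrite -xy; [exact: b|lia].
split=> [|n0].
  by exists z => // k kn; rewrite xy ?zx//; lia.
by rewrite !xy; [move=> /(hy n0) {}hy j jn; rewrite xy ?hy//; lia|lia].
Qed.

Lemma gap_shift_star : gap_shift (fun=> None).
Proof.
move=> i [|n] b; last by case: (b 0%N isT).
by split=> //; have [[z Zz] _ _] := subZ; exists z.
Qed.

Lemma subshift_gap_shift : subshift gap_shift.
Proof.
split; [exists (fun=> None); exact: gap_shift_star|exact: closed_gap_shift|].
by move=> _ [x Xx <-]; exact: (@gap_shift_shift x 1%N).
Qed.

Lemma dynamical_system_gap_shift : dynamical_system gap_shift f.
Proof.
split.
- exact/closed_compact/closed_gap_shift.
- exact/continuous_subspaceT/shift_map_continuous.
- by have [] := subshift_gap_shift.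
- have [[z Zz] _ _] := subZ; exists (fun=> None), (recode Some z).
  split; [exact: gap_shift_star|by apply: subset_gap_shift; exists z|].
  by move=> /(congr1 (fun x => x 0%N)).
Qed.

(** Without stars every prefix is a word of Z, and Z is closed. *)
Lemma recode_mem x : gap_shift x -> (forall k, x k <> None) -> ZB x.
Proof.
move=> Xx x_some.
have xE k : {a | x k = Some a} by case: (x k) (x_some k) => // a _; exists a.
exists (fun k => projT1 (xE k)).
  have [_ /closed_agreeP cZ _] := subZ; apply: cZ => n.
  have [|[z Zz zx] _] := Xx 0%N n; first by move=> k _; exact: x_some.
  exists z => // k kn; have := zx _ kn; rewrite add0n.
  by case: (xE k) => a /= -> [].
by apply/funext => k; rewrite /recode; case: (xE k) => a /= ->.
Qed.

Lemma closed_recode : closed ZB.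
Proof.
apply/closed_agreeP => x h; apply: recode_mem.
  have /closed_agreeP := closed_gap_shift; apply=> m.
  by have [y Zy xy] := h m; exists y => //; exact: subset_gap_shift.
by move=> k; have [_ [z Zz <-] ->] := h k.+1.
Qed.

Lemma recode_shift x : ZB x -> ZB (f x).
Proof.
move=> [z Zz <-]; exists (shift_map z) => //.
by have [_ _] := subZ; apply; exists z.
Qed.

Lemma frequent_star x : (gap_shift `\` \bigcup_i (iter i f @^-1` ZB)) x ->
  forall N, exists2 n, (N <= n)%N & x n = None.
Proof.
move=> [Xx nZ] N; apply: contrapT => nn; apply: nZ; exists N => //=.
apply: recode_mem; first exact: gap_shift_shift.
by move=> k xk; apply: nn; exists (N + k)%N;
  rewrite ?leq_addr// -iter_shift_mapE.
Qed.

Lemma periodicMn x p : (forall i, x (i + p)%N = x i) ->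
  forall q i, x (i + q * p)%N = x i.
Proof.
move=> xp; elim=> [|q ih] i; first by rewrite addn0.
by rewrite mulSn addnCA addnC xp ih.
Qed.

(* A star at the end of the period confines every block to one period. *)
Lemma periodic_gap_shift y p : (0 < p)%N -> (forall i, y (i + p)%N = y i) ->
  y p.-1 = None -> (forall i n, (i + n < p)%N -> admissible y i n) ->
  gap_shift y.
Proof.
move=> p0 yp yp1 adm i [|n] b.
  by split=> //; have [[z Zz] _ _] := subZ; exists z.
have yE j : y (i + j)%N = y (i %% p + j)%N.
  by rewrite {1}(divn_eq i p) -addnA addnC periodicMn.
have ltp : (i %% p + n.+1 < p)%N.
  rewrite ltnNge; apply/negP => pin.
  have ip : (i %% p < p)%N by rewrite ltn_mod.
  apply: (b (p.-1 - i %% p)%N); first by lia.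
  by rewrite yE subnKC//; lia.
have [|[z Zz zy] h] := adm _ _ ltp; first by move=> k kn; rewrite -yE; exact: b.
split=> [|_]; first by exists z => // k kn; rewrite yE zy.
by rewrite yE => yin j jg; rewrite -addnA yE addnA h.
Qed.

(** One period holds the words at their places and stars elsewhere. A gap of g (L i) after word i is
    enough, because a block inside that word has length at most L i and [g] is monotone. *)
Lemma glue_words k p (x : nat -> fullshift R (option A)) (s L : nat -> nat) :
  (0 < k)%N -> (forall i, (i < k)%N -> gap_shift (x i)) ->
  (forall i, (i < k)%N -> (0 < L i)%N) -> s 0%N = 0%N ->
  (forall i, (i.+1 < k)%N -> (s i + L i + g (L i) <= s i.+1)%N) ->
  (s k.-1 + L k.-1 + g (L k.-1) <= p)%N ->
  exists y, [/\ gap_shift y, forall i, y (i + p)%N = y i &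
    forall i j, (i < k)%N -> (j < L i)%N -> y (s i + j)%N = x i j].
Proof.
move=> k0 Xx L0 s0 sS sp.
have smono i j : (i < j < k)%N -> (s i + L i + g (L i) <= s j)%N.
  elim: j => // j ih /andP[]; rewrite ltnS leq_eqVlt => /predU1P[->|ij] jk.
    exact: sS.
  have := sS _ jk; have := ih; rewrite ij (ltnW jk) => /(_ isT); lia.
have slast i : (i < k)%N -> (s i + L i + g (L i) <= p)%N.
  move=> ik; have [->//|ik1] := eqVneq i k.-1.
  by have := @smono i k.-1; have := L0 k.-1; lia.
pose y0 q := if [pick i : 'I_k | (s i <= q < s i + L i)%N] is Some i
  then x i (q - s i)%N else None.
have y0E i q : (i < k)%N -> (s i <= q < s i + L i)%N -> y0 q = x i (q - s i)%N.
  move=> ik iq; rewrite /y0; case: pickP => [j jq|/(_ (Ordinal ik))];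
    last first.
    by rewrite /= iq.
  suff -> : i = j by [].
  have := @smono i j; have := @smono j i; have := ltn_ord j.
  by have [] := ltngtP i j => //; lia.
have y0N i q : (i < k)%N -> (s i + L i <= q < s i + L i + g (L i))%N ->
    y0 q = None.
  move=> ik iq; rewrite /y0; case: pickP => [j jq|//].
  have := @smono i j; have := @smono j i; have := ltn_ord j.
  by have [||ji] := ltngtP i j; last rewrite ji in iq *; lia.
have y0in q : y0 q <> None -> exists2 i, (i < k)%N & (s i <= q < s i + L i)%N.
  by rewrite /y0; case: pickP => // i iq _; exists i.
have p0 : (0 < p)%N by have := slast _ k0; have := L0 _ k0; lia.
pose y q := y0 (q %% p)%N.
have yE q : (q < p)%N -> y q = y0 q by move=> qp; rewrite /y modn_small.
exists y; split; last 2 first.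
- by move=> i; rewrite /y modnDr.
- move=> i j ik jL; rewrite yE ?(@y0E i)//; try (by have := slast _ ik; lia).
  by rewrite addKn.
apply: (@periodic_gap_shift y p) => //.
- by move=> i; rewrite /y modnDr.
- rewrite yE; last by lia.
  apply: contrapT => /y0in[i ik]; have := slast _ ik; have := g_gt0 (L0 _ ik).
  by lia.
move=> i [|n] ip b; first by split=> //; have [[z Zz] _ _] := subZ; exists z.
have [|w wk wi] := y0in i.
  by have := b 0%N isT; rewrite addn0 yE//; lia.
(* A block that starts in word w stays in it, since the position just after the word carries a
   star. *)
have blk j : (j <= n)%N -> (s w <= i + j < s w + L w)%N.
  elim: j => [|j ih] jn; first by rewrite addn0.
  have := ih (ltnW jn) => wij.
  have [//|wij1] := ltnP (i + j.+1)%N (s w + L w)%N; first by lia.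
  have := b j.+1; rewrite yE; last by lia.
  by rewrite (y0N w)//; [move=> /(_ jn)|have := g_gt0 (L0 _ wk); lia].
have iE j : (i + j < p)%N -> (i + j < s w + L w)%N ->
    y (i + j)%N = x w (i - s w + j)%N.
  move=> ijp ijw; rewrite yE// (y0E w)//; last by lia.
  by congr (x w _); lia.
have bn := blk n (leqnn _).
have slw := slast _ wk.
have [|[z Zz zx] h] := Xx _ wk (i - s w)%N n.+1.
  by move=> j jn; rewrite -iE; [exact: b|lia|have := blk _ jn; lia].
split=> [|_].
  by exists z => // j jn; rewrite -zx// iE//; [lia|have := blk _ jn; lia].
move=> yin j jg.
have gn : (g n.+1 <= g (L w))%N by apply: g_nd; lia.
rewrite yE; last by lia.
(* A star required inside word w is already present in [x w]; one required beyond its end lies in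
   the padding. *)
have [wij|wij] := ltnP (i + n.+1 + j)%N (s w + L w)%N; last first.
  by rewrite (y0N w)//; lia.
rewrite (y0E w)//; last by lia.
rewrite iE in yin; [|lia|lia].
by rewrite -(h isT yin _ jg); congr (x w _); lia.
Qed.

(* The prefix that is repeated ends with a completed run of stars. *)
Lemma frequent_periodic x : gap_shift x ->
  (forall N, exists2 n, (N <= n)%N & x n = None) ->
  forall N, exists p y, [/\ (N < p)%N, gap_shift y,
    forall i, y (i + p)%N = y i, agree p x y & y p.-1 = None].
Proof.
move=> Xx star N.
(* It is enough to find a cut p, preceded by a star, such that every gap opened before p is also
   completed before p. *)
suff [p [Np xp1 adm]] : exists p, [/\ (N < p)%N, x p.-1 = None &
    forall i n j, (i + n < p)%N -> (0 < n)%N -> block x i n ->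
      x (i + n)%N = None -> (j < g n)%N -> (i + n + j < p)%N].
  pose y q := x (q %% p)%N.
  have yE q : (q < p)%N -> y q = x q by move=> qp; rewrite /y modn_small.
  have yp i : y (i + p)%N = y i by rewrite /y modnDr.
  have yp1 : y p.-1 = None by rewrite yE//; lia.
  exists p, y; split=> //; last by move=> q qp; rewrite yE.
  apply: (@periodic_gap_shift y p) => //; first by lia.
  move=> i n ip b.
  have bx : block x i n by move=> k kn; rewrite -yE; [exact: b|lia].
  have [[z Zz zx] h] := Xx i n bx; split.
    by exists z => // k kn; rewrite yE ?zx//; lia.
  move=> n0; rewrite yE// => xin j jg.
  by rewrite yE ?(h n0 xin)//; exact: (adm i n j).
have [some|] := pselect (forall N, exists n, (N <= n)%N /\ x n <> None).
  (* With infinitely many letters, the cut is placed at the first letter after a star s >= N: a gap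
     still running there would forbid that letter. *)
  have [s Ns xs] := star N.
  have ex : exists n, (s <= n)%N && isSome (x n).
    by have [n [sn xn]] := some s; exists n; rewrite sn; case: (x n) xn.
  case: (ex_minnP ex) => p /andP[sp xp] pmin; exists p.
  have sp' : (s < p)%N.
    by rewrite ltn_neqAle sp andbT; apply/eqP => spE; rewrite -spE xs in xp.
  split; first by lia.
  - case xp1: (x p.-1) => [a|//].
    by have := pmin p.-1; rewrite xp1 andbT => /(_ _); lia.
  - move=> i n j ip n0 b xin jg; rewrite ltnNge; apply/negP => pij.
    have [_ /(_ n0 xin (p - (i + n))%N)] := Xx i n b.
    by rewrite subnKC; [move=> h; rewrite h in xp => //; lia|lia].
move=> /existsNP[N0 /forallNP nsome].
have xN n : (N0 <= n)%N -> x n = None.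
  by move=> Nn; apply: contrapT => xn; exact: (nsome n).
(* With no letter from N0 on, every block ends by N0, so leaving room for [g N0] stars completes all
   gaps. *)
exists (N + N0 + g N0).+1; split; [lia|by apply: xN; lia|].
move=> i n j ip n0 b xin jg.
have iN : (i + n <= N0)%N.
  rewrite leqNgt; apply/negP => iN; apply: (b n.-1); first by lia.
  by apply: xN; lia.
have := @g_nd n N0; lia.
Qed.

(** The initial block runs on to the first star r >= n and is followed by at least g r >= g n stars,
    which postpones the letter at q.+1. *)
Lemma star_gap z x n q : gap_shift x -> Z z ->
  (forall k, (k < n)%N -> x k = Some (z k)) -> (0 < n)%N ->
  (n <= q)%N -> x q = None -> x q.+1 <> None -> (g n <= q.+1 - n)%N.
Proof.
move=> Xx Zz xz n0 nq xq xq1.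
have ex : exists r, (n <= r)%N && ~~ isSome (x r) by exists q; rewrite nq xq.
case: (ex_minnP ex) => r /andP[nr xr] rmin.
have b : block x 0%N r.
  move=> k kr; rewrite add0n => xk; have [kn|nk] := ltnP k n.
    by rewrite xz in xk.
  by have := rmin k; rewrite nk xk => /(_ isT); lia.
have rq : (r <= q)%N by apply: rmin; rewrite nq xq.
have [_ h] := Xx 0%N r b.
have xr0 : x (0 + r)%N = None by rewrite add0n; case: (x r) xr.
have := h (leq_trans n0 nr) xr0 (q.+1 - r)%N.
have := g_nd nr.
rewrite add0n subnKC; last by lia.
move=> gr h'; rewrite leqNgt; apply/negP => qg; apply: xq1; apply: h'; lia.
Qed.

End gap_shift.

(** * Gap functions of the gap shift *)

Section gap_shift_specification.
Context {R : realType} (A : finType) (Z : set (fullshift R A)) (g : nat -> nat).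
Hypotheses (subZ : subshift Z) (g_nd : {homo g : m n / (m <= n)%N}).
Hypothesis (g_gt0 : forall n, (0 < n)%N -> (0 < g n)%N).

Local Notation f := (@shift_map R (option A)).
Local Notation X := (gap_shift Z g).

Definition window (e : R) : nat := (Num.truncn (2 / e)).+1.

Lemma window_le (e : R) : 0 < e -> 2 * 2 ^- window e <= e.
Proof.
move=> e0; rewrite ler_pdivrMr ?exprn_gt0// mulrC -ler_pdivrMr//.
apply: le_trans (ltW (truncnS_gt _)) _.
by rewrite -natrX ler_nat ltnW// ltn_expl.
Qed.

Lemma window_nincr (e e' : R) : 0 < e -> e <= e' -> (window e' <= window e)%N.
Proof.
move=> e0 ee'; rewrite ltnS; apply: le_truncn.
by rewrite ler_pM2l// lef_pV2 ?posrE// (lt_le_trans e0).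
Qed.

(** Shadowing up to e at the last time of a segment fixes [window e] further symbols, so a segment
    of length n becomes a word of length n + window e. The successor appears because gaps are
    counted from the last time of the segment. The window does not depend on n and hence does not
    affect the rate. *)
Definition gap_shift_gap (n : nat) (e : R) : nat :=
  (window e + g (n + window e)).+1.

Lemma gap_shift_periodic_specification (e : R) k
    (x : nat -> fullshift R (option A)) (a b : nat -> nat) p :
  0 < e -> (0 < k)%N ->
  (forall i, (i < k)%N -> X (x i)) ->
  (forall i, (i < k)%N -> (a i <= b i)%N) ->
  (forall i, (i.+1 < k)%N -> (b i < a i.+1)%N) ->
  (forall i, (i.+1 < k)%N ->
     (gap_shift_gap (b i - a i).+1 e <= a i.+1 - b i)%N) ->
  (b k.-1 - a 0%N + gap_shift_gap (b k.-1 - a k.-1).+1 e <= p)%N ->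
  exists z, [/\ X z, shadows f e k x a b z & iter p f z = z].
Proof.
move=> e0 k0 Xx ab ba gapE pE; set m := window e.
have amono i : (i < k)%N -> (a 0%N <= a i)%N.
  elim: i => // i ih ik; have := ih (ltnW ik).
  by have := ab i (ltnW ik); have := ba i ik; lia.
have [||||||y [Xy yp yx]] := @glue_words R A Z g subZ g_nd g_gt0 k p x
    (fun i => a i - a 0)%N (fun i => ((b i - a i).+1 + m)%N) => //.
- by rewrite subnn.
- move=> i ik; have := gapE i ik; rewrite /gap_shift_gap -/m.
  have := amono i (ltnW ik); have := amono _ ik; have := ab i (ltnW ik).
  by have := ba i ik; lia.
- have k1 : (k.-1 < k)%N by lia.
  have := amono _ k1; have := ab _ k1; move: pE; rewrite /gap_shift_gap -/m;
    lia.
have p0 : (0 < p)%N by move: pE; rewrite /gap_shift_gap -/m; lia.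
have c0 : (a 0 <= a 0 * p)%N by rewrite leq_pmulr.
(* The glued point starts its first word at time 0; shifting by -a 0 modulo p moves word i to time a
   i. *)
exists (iter (a 0 * p - a 0)%N f y); split.
- exact: gap_shift_shift.
- move=> i n ik /andP[an nb].
  apply: le_trans (window_le e0); apply: agree_mdist => j jm.
  have ai := amono i ik.
  rewrite -iterD !iter_shift_mapE -yx//; last by rewrite /m; lia.
  rewrite -(@periodicMn _ _ _ _ yp (a 0%N)); congr (y _); lia.
- apply/funext => j; rewrite -iterD !iter_shift_mapE.
  by rewrite -[RHS]yp; congr (y _); lia.
Qed.

Lemma gap_function_gap_shift : gap_function X f gap_shift_gap.
Proof.
split=> //.
- by move=> m n e _ mn _; rewrite ltnS leq_add2l; apply: g_nd; lia.
- move=> n e e' _ e0 ee'; have := window_nincr e0 ee' => ww.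
  by rewrite ltnS leq_add//; apply: g_nd; lia.
- move=> e k x a b e0 k2 Xx ab ba gapE; have k0 : (0 < k)%N by lia.
  have spec := @gap_shift_periodic_specification e k x a b _ e0 k0 Xx ab ba
    gapE.
  split; last by move=> p _ /spec.
  by have [z [Xz zx _]] := spec _ (leqnn _); exists z.
Qed.

(** Two segments are prescribed, n letters of a point of Z and, at distance exactly M n e, a star
    followed by a letter. At scale e < 1 shadowing reproduces the symbols, and [star_gap] applies to
    the shadowing point. *)
Lemma gap_function_ge M n (e : R) : gap_function X f M ->
  (0 < n)%N -> 0 < e -> e < 1 -> (g n <= M n e)%N.
Proof.
move=> [M0 _ _ spec] n0 e0 e1.
have [[z Zz] _ _] := subZ.
have Mn0 := M0 n e n0 e0.
pose z1 : fullshift R (option A) := recode Some z.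
pose z2 : fullshift R (option A) :=
  fun i => if i is j.+1 then Some (z j) else None.
have Xz1 : X z1 by apply: subset_gap_shift => //; exists z.
have Xz2 : X z2.
  move=> [|i] [|n'] b.
  - by split=> //; exists z.
  - by case: (b 0%N isT).
  - by split=> //; exists z.
  - by have := Xz1 i n'.+1 b.
pose q := (n.-1 + M n e)%N.
have [||||[w Xw sw] _] := spec e 2%N (fun i => if i is 0%N then z1 else z2)
    (fun i => if i is 0%N then 0%N else q)
    (fun i => if i is 0%N then n.-1 else q.+1) e0 isT.
- by case.
- by case=> [|i] _ //; lia.
- by case=> [|i] //; rewrite /q; lia.
- by case=> [|i] //; rewrite subn0 prednK// /q addKn.
have close (u v : fullshift R (option A)) : mdist u v <= e -> u 0%N = v 0%N.
  move=> uv; apply: (@mdist_agree R _ 0%N u v) => //.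
  by rewrite expr0 invr1 (le_lt_trans uv).
have wz k : (k < n)%N -> w k = Some (z k).
  move=> kn; have /= := sw 0%N k isT; rewrite subn0 => /(_ _)/close.
  by rewrite !iter_shift_mapE !addn0 => <-//; lia.
have w2 k : (k <= 1)%N -> w (q + k)%N = z2 k.
  move=> k1; have /= := sw 1%N (q + k)%N isT; rewrite addKn => /(_ _)/close.
  by rewrite !iter_shift_mapE !addn0 => <-//; lia.
have := @star_gap R A Z g g_nd z w n q Xw Zz wz n0.
have := w2 0%N isT; have := w2 1%N isT; rewrite addn0 addn1 /= => -> ->.
have -> : (q.+1 - n)%N = M n e by rewrite /q; lia.
by apply => //; rewrite /q; lia.
Qed.

End gap_shift_specification.

(** * Finite-dimensional sets *)

Section finite_dimensional_sets.
Context {R : realType} (B : alphabetType).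
Local Notation T := (fullshift R B).
Implicit Types (x y : T) (C D E U : set T).

(** Equivalently, C is a union of cylinders of length m; one implication suffices because [agree] is
    symmetric. *)
Definition fdim m C := forall x y, agree m x y -> C x -> C y.

Lemma fdimC m C : fdim m C -> fdim m (~` C).
Proof.
by move=> h x y xy nCx Cy; apply: nCx; apply: h Cy; exact: agree_sym.
Qed.

Lemma fdim_le m n C : (m <= n)%N -> fdim m C -> fdim n C.
Proof. by move=> mn h x y /(agree_le mn); exact: h. Qed.

Lemma fdimU m C D : fdim m C -> fdim m D -> fdim m (C `|` D).
Proof. by move=> hC hD x y xy [/(hC _ _ xy)|/(hD _ _ xy)]; [left|right]. Qed.

Lemma fdimI m C D : fdim m C -> fdim m D -> fdim m (C `&` D).
Proof. by move=> hC hD x y xy [/(hC _ _ xy) ? /(hD _ _ xy)]. Qed.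

Definition fin_dim C := exists m, fdim m C.

Lemma fin_dim0 : fin_dim set0. Proof. by exists 0%N => x y _. Qed.

Lemma fin_dimT : fin_dim setT. Proof. by exists 0%N => x y _. Qed.

Lemma fin_dimC C : fin_dim C -> fin_dim (~` C).
Proof. by move=> [m /fdimC]; exists m. Qed.

Lemma fin_dimU C D : fin_dim C -> fin_dim D -> fin_dim (C `|` D).
Proof.
move=> [m hC] [n hD]; exists (maxn m n).
by apply: fdimU; [apply: fdim_le hC|apply: fdim_le hD];
  rewrite ?leq_maxl ?leq_maxr.
Qed.

Lemma fin_dimI C D : fin_dim C -> fin_dim D -> fin_dim (C `&` D).
Proof.
move=> [m hC] [n hD]; exists (maxn m n).
by apply: fdimI; [apply: fdim_le hC|apply: fdim_le hD];
  rewrite ?leq_maxl ?leq_maxr.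
Qed.

Lemma fin_dim_coord n (P : pred B) : fin_dim [set x : T | P (x n)].
Proof. by exists n.+1 => x y xy /=; rewrite xy. Qed.

Lemma fin_dim_shift C : fin_dim C -> fin_dim (@shift_map R B @^-1` C).
Proof.
by move=> [m mC]; exists m.+1 => x y xy; apply: mC; exact: agree_shift_map.
Qed.

Lemma open_fin_dim C : fin_dim C -> open C.
Proof.
by move=> [m mC]; apply/open_agreeP => x Cx; exists m => y /mC; exact.
Qed.

Lemma closed_fin_dim C : fin_dim C -> closed C.
Proof. by move=> /fin_dimC/open_fin_dim; rewrite openC. Qed.

Lemma measurable_open U : open U -> measurable (U : set (borel T)).
Proof. exact: sub_sigma_algebra. Qed.

Lemma measurable_closed C : closed C -> measurable (C : set (borel T)).
Proof.
by move=> cC; rewrite -[C]setCK; apply: measurableC; apply: measurable_open;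
  rewrite openC.
Qed.

Lemma measurable_fin_dim C : fin_dim C -> measurable (C : set (borel T)).
Proof. by move=> /open_fin_dim; exact: measurable_open. Qed.

(** The largest subset of U determined by the first m coordinates. The cores exhaust an open set, so
    countable unions of finite-dimensional sets give all open sets. *)
Definition core m U : set T := [set x | forall y, agree m x y -> U y].

Lemma fdim_core m U : fdim m (core m U).
Proof. by move=> x y xy Ux z yz; apply: Ux; exact: agree_trans yz. Qed.

Lemma core_bigcup U : open U -> U = \bigcup_m core m U.
Proof.
move=> /open_agreeP oU; apply/seteqP; split => x.
  by move=> /oU[m mU]; exists m.
by move=> [m _]; apply.
Qed.

Lemma measurable_fin_dimE : @measurable _ (borel T) = <<s fin_dim >>.
Proof.
apply/seteqP; split; last first.
  apply: smallest_sub; first exact: sigma_algebra_measurable.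
  by move=> ? /measurable_fin_dim.
apply: smallest_sub; first exact: smallest_sigma_algebra.
move=> U oU; rewrite (core_bigcup oU).
have [_ _] := @smallest_sigma_algebra _ setT fin_dim; apply => m.
by apply: sub_sigma_algebra; exists m; exact: fdim_core.
Qed.

(** The measurable sets that can be approximated in this sense form a sigma-algebra. A countable
    union is first cut to finitely many members, at cost e / 2, and these are then approximated one
    by one. *)
Lemma fin_dim_approx (mu : probability (borel T) R) (E : set (borel T))
    (e : R) :
  measurable E -> 0 < e ->
  exists2 C, fin_dim C & (mu ((E `\` C) `|` (C `\` E)) < e%:E)%E.
Proof.
pose G := [set E : set (borel T) | measurable E /\ forall e : R, 0 < e ->
  exists2 C, fin_dim C & (mu ((E `\` C) `|` (C `\` E)) < e%:E)%E].
suff : @measurable _ (borel T) `<=` G by move=> h /h[_]; exact.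
rewrite {1}measurable_fin_dimE; apply: smallest_sub; last first.
  move=> C fC; split; first exact: measurable_fin_dim.
  by move=> {}e e0; exists C => //; rewrite setDv setU0 measure0 lte_fin.
split.
- split=> // {}e e0; exists set0; first exact: fin_dim0.
  by rewrite setDv setU0 measure0 lte_fin.
- move=> D [mD hD]; split; first by rewrite setTD; exact: measurableC.
  move=> {}e /hD[C fC CD]; exists (~` C); first exact: fin_dimC.
  apply: le_lt_trans CD; rewrite setTD !setDE !setCK.
  by rewrite setUC [_ `&` C]setIC [~` C `&` _]setIC.
change (forall D : (set (borel T))^nat, (forall n, G (D n)) ->
  G (\bigcup_n D n)) => D hD.
have mD k : measurable (D k) by have [] := hD k.
have mDU : measurable (\bigcup_k D k) by exact: bigcupT_measurable.
split => // {}e e0.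
have e20 : 0 < e / 2 by rewrite divr_gt0.
pose DN N := \big[setU/set0]_(k < N) D k.
have mDN N : measurable (DN N) by exact: bigsetU_measurable.
have [N DNe] : exists N, (mu (\bigcup_k D k `\` DN N) < (e / 2)%:E)%E.
  have : mu \o (fun N => \bigcup_k D k `\` DN N) @ \oo -->
      mu (\bigcap_N (\bigcup_k D k `\` DN N)).
    apply: nonincreasing_cvg_mu.
    - by apply: le_lt_trans (probability_le1 _ _) (ltry _); exact: measurableD.
    - by move=> N; exact: measurableD.
    - by apply: bigcapT_measurable => N; exact: measurableD.
    - move=> m n mn; apply/subsetPset; apply: setDS; exact: subset_bigsetU.
  rewrite (_ : \bigcap__ _ = set0); last first.
    rewrite -subset0 => x h; have [[k _ Dk] _] := h 0%N I.
    have [_] := h k.+1 I; apply; rewrite /DN big_ord_recr/=; by right.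
  rewrite measure0 => /fine_cvgP[_ /cvgrPdist_lt].
  move=> /(_ _ e20)[N _ /(_ _ (leqnn N))].
  rewrite /= sub0r normrN => h; exists N.
  rewrite -[mu _]fineK ?fin_num_measure ?lte_fin//; last exact: measurableD.
  exact: le_lt_trans (ler_norm _) h.
(* The N members share the other e / 2; dividing by N.+1 avoids a zero denominator. *)
have eN0 : 0 < e / 2 / N.+1%:R by rewrite divr_gt0.
have /choice[C hC] k : exists C, fin_dim C /\
    (mu ((D k `\` C) `|` (C `\` D k)) < (e / 2 / N.+1%:R)%:E)%E.
  by have [C fC CD] := (hD k).2 _ eN0; exists C.
have mC k : measurable (C k : set (borel T)).
  by apply: measurable_fin_dim; have [] := hC k.
exists (\big[setU/set0]_(k < N) C k).
  by elim/big_ind: _ => [|? ?|k _];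
    [exact: fin_dim0|exact: fin_dimU|exact: (hC k).1].
have mS k : measurable ((D k `\` C k) `|` (C k `\` D k)).
  by apply: measurableU; exact: measurableD.
pose S := \big[setU/set0]_(k < N) ((D k `\` C k) `|` (C k `\` D k)).
have mmS : measurable S by exact: bigsetU_measurable.
apply: (@le_lt_trans _ _ (mu ((\bigcup_k D k `\` DN N) `|` S))).
  apply: le_measure; rewrite ?inE.
  - by apply: measurableU; apply: measurableD => //; exact: bigsetU_measurable.
  - by apply: measurableU => //; exact: measurableD.
  have -> : S = \bigcup_(k in `I_N) ((D k `\` C k) `|` (C k `\` D k)).
    by rewrite bigcup_mkord.
  rewrite /DN -!bigcup_mkord => x [[[k _ Dkx] nCx]|[[k kN Ckx] nDx]].
    have [[l lN Dlx]|nDNx] := pselect ((\bigcup_(i in `I_N) D i) x).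
      right; exists l => //; left; split=> // Clx.
      by apply: nCx; exists l.
    by left; split=> //; exists k.
  right; exists k => //; right; split=> // Dkx.
  by apply: nDx; exists k.
apply: (@le_lt_trans _ _ (mu (\bigcup_k D k `\` DN N) + mu S)%E).
  by apply: measureU2 => //; exact: measurableD.
rewrite [ltRHS](_ : _ = (e / 2)%:E + (e / 2)%:E)%E;
  last by rewrite -EFinD -splitr.
apply: lte_leD => //; first by rewrite fin_num_measure.
apply: (@le_trans _ _ (\sum_(k < N) (e / 2 / N.+1%:R)%:E)%E).
  apply: (@le_trans _ _ (\sum_(k < N) mu ((D k `\` C k) `|` (C k `\` D k)))%E).
    exact: (@content_subadditive _ _ _ mu S (fun k =>
      (D k `\` C k) `|` (C k `\` D k))).
  by apply: lee_sum => k _; apply: ltW; have [] := hC k.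
rewrite sumEFin sumr_const card_ord lee_fin -[_ *+ N]mulr_natl.
rewrite mulrCA ger_pMr// ler_pdivrMr// mul1r ler_nat.
exact: leqnSn.
Qed.

End finite_dimensional_sets.

(** * Finite-valued random variables and Gibbs' inequality *)

Section finite_valued.
Context d (T : measurableType d) (R : realType) (mu : probability T R).

Definition finite_valued (I : finType) (W : T -> I) :=
  forall i, measurable (W @^-1` [set i]).

Definition law (I : finType) (W : T -> I) (i : I) : R :=
  fine (mu (W @^-1` [set i])).

Lemma law_ge0 (I : finType) (W : T -> I) i : 0 <= law W i.
Proof. exact: fine_ge0. Qed.

Lemma preimage_cons (I : finType) (W : T -> I) i s :
  W @^-1` [set j | j \in i :: s] =
  (W @^-1` [set i]) `|` (W @^-1` [set j | j \in s]).
Proof.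
apply/seteqP; split => x /=.
  by rewrite inE => /predU1P[]; [left|right].
by rewrite inE => -[/eqP->//|->]; rewrite orbT.
Qed.

Lemma finite_valued_seq (I : finType) (W : T -> I) (s : seq I) :
  finite_valued W -> measurable (W @^-1` [set i | i \in s]).
Proof.
move=> mW; elim: s => [|i s ih].
  by rewrite (_ : _ @^-1` _ = set0)//; apply/seteqP; split.
by rewrite preimage_cons; exact: measurableU.
Qed.

Lemma finite_valued_pred (I : finType) (W : T -> I) (P : pred I) :
  finite_valued W -> measurable (W @^-1` [set i | P i]).
Proof.
move=> /(finite_valued_seq (enum P)); congr (measurable _).
by apply/seteqP; split => x /=; rewrite mem_enum.
Qed.

Lemma law_pred (I : finType) (W : T -> I) (P : pred I) : finite_valued W ->
  fine (mu (W @^-1` [set i | P i])) = \sum_(i | P i) law W i.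
Proof.
move=> mW; have -> : [set i | P i] = [set i | i \in enum P].
  by apply/seteqP; split => x /=; rewrite mem_enum.
rewrite -big_enum/=.
elim: (enum P) (enum_uniq P) => [_|i s ih /= /andP[iNs us]].
  rewrite big_nil (_ : _ @^-1` _ = set0) ?measure0//.
  by apply/seteqP; split.
have ms := finite_valued_seq s mW.
rewrite big_cons -ih// preimage_cons measureU//; last first.
  rewrite -subset0 => x [/= -> ]; exact/negP.
by rewrite fineD// fin_num_measure.
Qed.

Lemma sum_law (I : finType) (W : T -> I) : finite_valued W ->
  \sum_i law W i = 1.
Proof.
move=> mW; rewrite -law_pred// (_ : _ @^-1` _ = setT) ?probability_setT//.
by apply/seteqP; split.
Qed.

Lemma law_le1 (I : finType) (W : T -> I) i : finite_valued W -> law W i <= 1.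
Proof.
move=> mW; rewrite -(sum_law mW) (bigD1 i)//= lerDl.
by apply: sumr_ge0 => j _; exact: law_ge0.
Qed.

Lemma finite_valued_comp (I J : finType) (W : T -> I) (h : I -> J) :
  finite_valued W -> finite_valued (h \o W).
Proof.
move=> mW j; have := finite_valued_pred (fun i => h i == j) mW.
by congr (measurable _); apply/seteqP; split => x /= /eqP.
Qed.

Lemma law_comp (I J : finType) (W : T -> I) (h : I -> J) j :
  finite_valued W -> law (h \o W) j = \sum_(i | h i == j) law W i.
Proof.
move=> mW; rewrite -law_pred//; congr (fine (mu _)).
by apply/seteqP; split => x /= /eqP.
Qed.

Lemma expect_comp (I J : finType) (W : T -> I) (h : I -> J) (F : J -> R) :
  finite_valued W ->
  \sum_j law (h \o W) j * F j = \sum_i law W i * F (h i).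
Proof.
move=> mW; rewrite [RHS](partition_big h predT)//=; apply: eq_bigr => j _.
rewrite law_comp// mulr_suml; apply: eq_bigr => i /eqP <- //.
Qed.

Lemma finite_valued_pair (I J : finType) (W : T -> I) (V : T -> J) :
  finite_valued W -> finite_valued V -> finite_valued (fun x => (W x, V x)).
Proof.
move=> mW mV [i j]; have := measurableI _ _ (mW i) (mV j).
by congr (measurable _); apply/seteqP; split=> x /= => [[-> ->]|[]].
Qed.

Lemma finite_valued_ffun n (J : finType) (V : 'I_n -> T -> J) :
  (forall i, finite_valued (V i)) ->
  finite_valued (fun x => [ffun i => V i x]).
Proof.
move=> mV w.
have -> : (fun x => [ffun i => V i x]) @^-1` [set w] =
    \big[setI/setT]_(i < n) (V i @^-1` [set w i]).
  apply/seteqP; split => x /=.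
    by move=> <-; elim/big_ind: _ => // i _ /=; rewrite ffunE.
  move=> h; apply/ffunP => i; rewrite ffunE.
  by move: h; rewrite (bigD1 i)//= => -[].
by elim/big_ind: _ => // => [? ? ? ?|i _]; [exact: measurableI|exact: mV].
Qed.

End finite_valued.

Section gibbs.
Context {R : realType}.

Lemma ln_prod (I : finType) (F : I -> R) : (forall i, 0 < F i) ->
  ln (\prod_i F i) = \sum_i ln (F i).
Proof.
move=> F0; have : 0 < \prod_i F i /\ ln (\prod_i F i) = \sum_i ln (F i).
  elim/big_rec2 : _ => [|i y x _ [x0 xE]]; first by rewrite ln1.
  by rewrite mulr_gt0// lnM ?posrE// xE.
by case.
Qed.

(** This is ln r <= r - 1 at r = q i / P (h i), combined with p i <= P (h i). The entropy is that of
    the image law P, while the weight q lives on the finer alphabet I, where a product form is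
    available. *)
Lemma gibbs (I J : finType) (h : I -> J) (p q : I -> R) (P : J -> R) :
  (forall i, 0 <= p i) -> \sum_i p i = 1 ->
  (forall i, 0 < q i) -> \sum_i q i <= 1 ->
  (forall j, P j = \sum_(i | h i == j) p i) ->
  - \sum_j P j * ln (P j) <= \sum_i p i * - ln (q i).
Proof.
move=> p0 p1 q0 q1 PE.
have -> : \sum_j P j * ln (P j) = \sum_i p i * ln (P (h i)).
  rewrite [RHS](partition_big h predT)//=; apply: eq_bigr => j _.
  by rewrite {1}PE mulr_suml; apply: eq_bigr => i /eqP <-.
rewrite -sumrN -subr_ge0 -sumrB.
apply: (@le_trans _ _ (\sum_i (p i - q i))).
  by rewrite sumrB p1 subr_ge0.
apply: ler_sum => i _.
(* The case p i = 0 is separate because P (h i) may then vanish. *)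
have := p0 i; rewrite le_eqVlt => /predU1P[<-|pi0].
  by rewrite !mul0r !oppr0 addr0 sub0r oppr_le0 ltW.
have Pp : p i <= P (h i).
  by rewrite PE (bigD1 i)//= lerDl; apply: sumr_ge0 => j _.
have P0 : 0 < P (h i) by exact: lt_le_trans Pp.
have qP0 : 0 < q i / P (h i) by rewrite divr_gt0.
have : ln (q i / P (h i)) <= q i / P (h i) - 1.
  rewrite -[in leLHS](subrK 1 (q i / _)) addrC; apply: le_ln1Dx.
  by rewrite ltrBrDr addNr.
rewrite ln_div ?posrE// => lnqP.
have : p i * (ln (q i) - ln (P (h i))) <= q i - p i.
  apply: le_trans (ler_wpM2l (p0 i) lnqP) _.
  rewrite mulrBr mulr1 lerD2r mulrCA ler_piMr ?ler_pdivrMr ?mul1r//.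
  exact: ltW.
lra.
Qed.

End gibbs.

(** * Invariant measures and generating partitions *)

Section shift_measures.
Context {R : realType} (B : alphabetType).
Local Notation T := (fullshift R B).
Local Notation f := (@shift_map R B).
Implicit Types (x y : T) (mu : probability (borel T) R).

Lemma measurable_preimage_shift (E : set (borel T)) :
  measurable E -> measurable (f @^-1` E : set (borel T)).
Proof.
pose G := [set E : set (borel T) | measurable (f @^-1` E : set (borel T))].
suff : @measurable _ (borel T) `<=` G by exact.
rewrite {1}measurable_fin_dimE; apply: smallest_sub; last first.
  by move=> C fC; apply: measurable_fin_dim; exact: fin_dim_shift.
split.
- by rewrite /G/= preimage_set0.
- by move=> D mD; rewrite /G/= setTD preimage_setC; exact: measurableC.
- move=> D mD; rewrite /G/= preimage_bigcup; exact: bigcupT_measurable.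
Qed.

Lemma measurable_preimage_iter n (E : set (borel T)) :
  measurable E -> measurable (iter n f @^-1` E : set (borel T)).
Proof.
elim: n => // n ih /ih/measurable_preimage_shift.
by congr (measurable _); apply/seteqP; split=> x /=; rewrite -iterSr.
Qed.

Definition shift_invariant mu :=
  forall E : set (borel T), measurable E -> mu (f @^-1` E) = mu E.

Lemma invariant_iter mu n (E : set (borel T)) : shift_invariant mu ->
  measurable E -> mu (iter n f @^-1` E) = mu E.
Proof.
move=> inv mE; elim: n => // n ih; rewrite -[RHS]ih -[RHS]inv; last first.
  exact: measurable_preimage_iter.
by congr (mu _); apply/seteqP; split=> x /=; rewrite -iterSr.
Qed.

Definition extend m (w : {ffun 'I_m -> B}) : T :=
  fun k => if insub k is Some i then w i else point.

Definition word m x : {ffun 'I_m -> B} := [ffun i : 'I_m => x i].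

Lemma extend_word m x : agree m (extend (word m x)) x.
Proof. by move=> k km; rewrite /extend insubT ffunE. Qed.

Lemma finite_valued_coord n : finite_valued (fun x : borel T => x n).
Proof.
by move=> b; apply: measurable_fin_dim; exists n.+1 => x y xy /=; rewrite xy.
Qed.

Lemma finite_valued_word m : finite_valued (word m : borel T -> _).
Proof.
by apply: (@finite_valued_ffun _ (borel T) m B (fun i x => (x : T) i)) => i;
  exact: finite_valued_coord.
Qed.

Lemma finite_valued_iter (I : finType) (W : T -> I) n :
  finite_valued (W : borel T -> I) ->
  finite_valued (W \o iter n f : borel T -> I).
Proof. by move=> mW i; exact: (measurable_preimage_iter n (mW i)). Qed.

Lemma law_iter mu (I : finType) (W : T -> I) n : shift_invariant mu ->
  finite_valued (W : borel T -> I) -> law mu (W \o iter n f) = law mu W.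
Proof.
by move=> inv mW; apply/funext => i; congr fine;
  exact: (invariant_iter n inv (mW i)).
Qed.

Definition fdim_fun m (I : Type) (W : T -> I) :=
  forall x y, agree m x y -> W x = W y.

Lemma fdim_fun_word m (I : finType) (W : T -> I) : fdim_fun m W ->
  W = (fun w => W (extend w)) \o word m.
Proof.
move=> h; apply/funext => x /=; apply: h; apply: agree_sym.
exact: extend_word.
Qed.

Lemma finite_valued_fdim m (I : finType) (W : T -> I) : fdim_fun m W ->
  finite_valued (W : borel T -> I).
Proof.
by move=> /fdim_fun_word ->; apply: finite_valued_comp;
  exact: finite_valued_word.
Qed.

(** Each fibre of [xi] is approximated by a finite-dimensional set C j up to e / k, and [theta]
    picks a label j with x in C j. Where the two labels differ, x lies in one of the symmetric
    differences. *)
Lemma partition_approx mu k (xi : T -> 'I_k) (e : R) :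
  finite_valued (xi : borel T -> 'I_k) -> 0 < e ->
  exists m (theta : T -> 'I_k), fdim_fun m theta /\
    law mu (fun x => xi x == theta x) false <= e.
Proof.
move=> mxi e0; have k0 : (0 < k)%N by apply: leq_ltn_trans (ltn_ord (xi point)).
have ek0 : 0 < e / k%:R by rewrite divr_gt0// ltr0n.
have /choice[C hC] (j : 'I_k) : exists C, fin_dim C /\
    (mu ((xi @^-1` [set j] `\` C) `|` (C `\` xi @^-1` [set j]))
      < (e / k%:R)%:E)%E.
  by have [C fC h] := fin_dim_approx mu (mxi j) ek0; exists C.
have /choice[mm hm] (j : 'I_k) : exists m, fdim m (C j).
  by have [[m h] _] := hC j; exists m.
pose m := \max_j mm j.
have Cm j : fdim m (C j) by apply: fdim_le (hm j); exact: leq_bigmax.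
pose theta x := odflt (xi point) [pick j | `[< C j x >]].
have thetam : fdim_fun m theta.
  move=> x y xy; rewrite /theta; congr odflt; apply: eq_pick => j /=.
  by apply/asboolP/asboolP; apply: Cm => //; exact: agree_sym.
exists m, theta; split => //.
pose D j : set (borel T) :=
  (xi @^-1` [set j] `\` C j) `|` (C j `\` xi @^-1` [set j]).
have mD j : measurable (D j).
  have mC : measurable (C j : set (borel T)).
    by apply: measurable_fin_dim; exists m.
  by apply: measurableU; apply: measurableD => //; exact: mxi.
have mU : measurable (\big[setU/set0]_(j < k) D j) by exact: bigsetU_measurable.
have sub : (fun x => xi x == theta x) @^-1` [set false] `<=`
    \big[setU/set0]_(j < k) D j.
  move=> x /= /negP xit.
  have inU j : D j x -> (\big[setU/set0]_(j < k) D j) x.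
    by move=> Djx; rewrite (bigD1 j)//=; left.
  apply: contrapT; move=> nD.
  apply: xit; rewrite /theta; case: pickP => [j /asboolP Cjx|/(_ (xi x))] /=.
    apply/eqP; apply: contrapT => xij.
    by apply: nD; apply: (inU j); right; split.
  by move=> /asboolPn nC; exfalso; apply: nD; apply: (inU (xi x)); left.
have mxt : measurable ((fun x => xi x == theta x) @^-1` [set false] :
  set (borel T)).
  have := finite_valued_comp (fun p => p.1 == p.2)
    (finite_valued_pair mxi (finite_valued_fdim thetam)).
  by move=> /(_ false).
rewrite -lee_fin /law fineK ?fin_num_measure//.
apply: (@le_trans _ _ (mu (\big[setU/set0]_(j < k) D j))).
  by apply: le_measure; rewrite ?inE.
apply: (@le_trans _ _ (\sum_(j < k) mu (D j))%E).
  have : measurable (\big[setU/set0]_(j < k) D j) /\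
    (mu (\big[setU/set0]_(j < k) D j) <= \sum_(j < k) mu (D j))%E.
    elim/big_rec2: _ => [|j S E _ [mE ES]]; first by rewrite measure0.
    split; first exact: measurableU.
    by apply: le_trans (measureU2 _ _ _) _ => //; rewrite leeD2l.
  by case.
apply: (@le_trans _ _ (\sum_(j < k) (e / k%:R)%:E)%E).
  by apply: lee_sum => j _; apply: ltW; have [] := hC j.
rewrite sumEFin lee_fin sumr_const card_ord -[_ *+ k]mulr_natl.
by rewrite mulrC divfK// pnatr_eq0 -lt0n.
Qed.

End shift_measures.

(** * Entropy *)

Section shift_entropy.
Context {R : realType} (B : alphabetType).
Local Notation T := (fullshift R B).
Local Notation f := (@shift_map R B).
Implicit Types (x y : T).
Variables (mu : probability (borel T) R) (q : B -> R).
Hypotheses (mu_inv : shift_invariant mu).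
Hypotheses (q_gt0 : forall b, 0 < q b) (q_le1 : \sum_b q b <= 1).

(** The cross entropy of the law of one coordinate relative to q, that is, the mean length in nats
    of the code given by q. *)
Definition coord_cost : R :=
  \sum_b law mu (fun x : borel T => x 0%N) b * - ln (q b).

Lemma q_ln_ge0 b : 0 <= - ln (q b).
Proof.
rewrite oppr_ge0 ln_le0//; apply: le_trans q_le1.
by rewrite (bigD1 b)//= lerDl; apply: sumr_ge0 => c _; exact: ltW.
Qed.

Lemma coord_cost_ge0 : 0 <= coord_cost.
Proof.
by apply: sumr_ge0 => b _; rewrite mulr_ge0 ?law_ge0// q_ln_ge0.
Qed.

(* Gibbs' inequality for the joint law of the first n + m letters u and the
   itinerary v of length n, against the weight that codes each letter by [q] and
   each label by its prediction [theta], up to errors of probability [e]. *)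
Lemma partition_entropy_le k (xi : T -> 'I_k) m (theta : T -> 'I_k) (e : R) n :
  finite_valued (xi : borel T -> 'I_k) -> fdim_fun m theta ->
  law mu (fun x => xi x == theta x) false <= e -> 0 < e -> e < 1 ->
  partition_entropy f mu xi n <=
    (n + m)%:R * coord_cost + n%:R * (e * - ln (e / k%:R) - ln (1 - e)).
Proof.
move=> mxi mtheta mis e0 e1.
have k0 : (0 < k)%N by apply: leq_ltn_trans (ltn_ord (xi point)).
have k1 : (1 : R) <= k%:R by rewrite ler1n.
have k0R : (0 : R) < k%:R by rewrite ltr0n.
pose Wt := ({ffun 'I_(n + m) -> B} * {ffun 'I_n -> 'I_k})%type.
pose V (x : borel T) : {ffun 'I_n -> 'I_k} :=
  [ffun i : 'I_n => xi (iter i f x)].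
pose W (x : borel T) := (@word R B (n + m) x, V x).
have mtheta' : finite_valued (theta : borel T -> 'I_k).
  exact: finite_valued_fdim mtheta.
have mW : finite_valued W.
  apply: finite_valued_pair; first exact: finite_valued_word.
  apply: (@finite_valued_ffun _ (borel T) n _ (fun i x => xi (iter i f x)))
    => i.
  exact: (finite_valued_iter _ mxi).
have -> : partition_entropy f mu xi n =
    - \sum_v law mu (snd \o W) v * ln (law mu (snd \o W) v).
  rewrite /partition_entropy; congr (- _); apply: eq_bigr => v _.
  suff -> : cylinder f xi v = (snd \o W) @^-1` [set v] by [].
  apply/seteqP; split => x /=.
    by move=> h; apply/ffunP => i; rewrite ffunE h.
  by move=> <- i; rewrite ffunE.
(* The predicted label gets weight 1 - e and every other label e / k, with total at most 1. *)
pose r (v s : 'I_k) : R := if v == s then 1 - e else e / k%:R.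
have r0 v s : 0 < r v s by rewrite /r; case: ifP; rewrite ?subr_gt0// divr_gt0.
have r1 s : \sum_v r v s <= 1.
  rewrite (bigD1 s)//= {1}/r eqxx -lerBrDl opprB addrC subrK.
  rewrite (eq_bigr (fun=> e / k%:R)); last by move=> v /negPf vs; rewrite /r vs.
  rewrite sumr_const -[_ *+ _]mulr_natl mulrC -mulrA ger_pMr// ler_pdivrMl//
    mulr1.
  by rewrite ler_nat -[leqRHS]card_ord max_card.
(* For i < n the prediction reads coordinates i to i + m - 1, which the n + m letters of u
   contain. *)
pose pred (u : {ffun 'I_(n + m) -> B}) (i : 'I_n) :=
  theta (iter i f (@extend R B _ u)).
pose Q (w : {ffun 'I_(n + m) -> B} * {ffun 'I_n -> 'I_k}) :=
  \prod_i q (w.1 i) * \prod_i r (w.2 i) (pred w.1 i).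
have Q0 w : 0 < Q w by rewrite mulr_gt0// prodr_gt0.
have Q1 : \sum_w Q w <= 1.
  rewrite -(pair_bigA _ (fun u v => Q (u, v)))/=.
  apply: (@le_trans _ _ (\sum_(u : {ffun 'I_(n + m) -> B}) \prod_i q (u i))).
    apply: ler_sum => u _; rewrite /Q/= -mulr_sumr ler_piMr//.
      by apply: prodr_ge0 => i _; exact: ltW.
    rewrite -(bigA_distr_bigA (fun i v => r v (pred u i))).
    apply: prodr_ile1 => i _; rewrite r1 andbT.
    by apply: sumr_ge0 => v _; exact: ltW.
  rewrite -(bigA_distr_bigA (fun (i : 'I_(n + m)) b => q b)).
  apply: prodr_ile1 => i _; rewrite q_le1 andbT.
  by apply: sumr_ge0 => v _; exact: ltW.
have QE w : - ln (Q w) = \sum_i - ln (q (w.1 i)) +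
    \sum_i - ln (r (w.2 i) (pred w.1 i)).
  by rewrite /Q lnM ?posrE ?prodr_gt0// !ln_prod// opprD -!sumrN.
apply: le_trans (gibbs (law_ge0 mu W) (sum_law mu mW) Q0 Q1
  (fun v => law_comp mu snd v mW)) _.
under eq_bigr do rewrite QE mulrDr 2!mulr_sumr.
rewrite big_split/= lerD//.
  rewrite exchange_big/= mulr_natl.
  have -> : coord_cost *+ (n + m) = \sum_(i < n + m) coord_cost.
    by rewrite sumr_const card_ord.
  apply: ler_sum => i _.
  rewrite -(expect_comp mu (fun w : Wt => w.1 i) (fun b => - ln (q b)) mW).
  rewrite (_ : (fun w : Wt => w.1 i) \o W = (fun x : T => x 0%N) \o iter i f).
    by rewrite law_iter//; exact: finite_valued_coord.
  by apply/funext => x; rewrite /= ffunE iter_shift_mapE addn0.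
set cost := (X in n%:R * X).
have -> : n%:R * cost = \sum_(i < n) cost.
  by rewrite sumr_const card_ord mulr_natl.
rewrite exchange_big/=.
apply: ler_sum => i _.
pose F (b : bool) : R := - ln (if b then 1 - e else e / k%:R).
rewrite (eq_bigr (fun w => law mu W w * F (w.2 i == pred w.1 i)))//.
rewrite -(expect_comp mu (fun w : Wt => w.2 i == pred w.1 i) F mW).
pose D (x : T) := xi x == theta x.
have mD : finite_valued (D : borel T -> bool).
  exact: (finite_valued_comp (fun p => p.1 == p.2)
    (finite_valued_pair mxi mtheta')).
rewrite (_ : (fun w : Wt => w.2 i == pred w.1 i) \o W = D \o iter i f);
  last first.
  apply/funext => x; rewrite /= ffunE /D; congr (_ == _).
  apply: mtheta => j jm; rewrite !iter_shift_mapE extend_word//.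
  by have := ltn_ord i; lia.
(* A wrong prediction has probability at most e and costs - ln (e / k); a right one costs - ln (1 -
   e), with probability bounded by 1. *)
rewrite law_iter// big_bool/= addrC lerD//.
  rewrite ler_wpM2r//; rewrite /F oppr_ge0 ln_le0//.
  by rewrite ler_pdivrMr// mul1r; lra.
rewrite /F ler_piMl ?law_le1//.
by rewrite oppr_ge0 ln_le0//; lra.
Qed.

Lemma prediction_cost (k : nat) (eta : R) : (0 < k)%N -> 0 < eta ->
  exists e : R, [/\ 0 < e, e < 1 & e * - ln (e / k%:R) - ln (1 - e) <= eta].
Proof.
move=> k0 eta0; have k0R : (0 : R) < k%:R by rewrite ltr0n.
have lnk : 0 <= ln (k%:R : R) by rewrite ln_ge0// ler1n.
(* With e = d * d, the bound d * - ln d <= 1 gives e * - ln e <= 2 d. Also - ln (1 - e) <= 2 e <= d,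
   so the total is at most d * (3 + ln k). *)
pose d := Num.min (2^-1) (eta / (4 + ln k%:R)).
have c0 : 0 < 4 + ln (k%:R : R) by lra.
have d0 : 0 < d by rewrite lt_min invr_gt0 ltr0n divr_gt0.
have d2 : d <= 2^-1 by rewrite ge_min lexx.
have dd0 : 0 < d * d by rewrite mulr_gt0.
have ddle : d * d <= 2^-1 * d by rewrite ler_pM2r.
have dd4 : d * d <= 2^-1 by lra.
exists (d * d); split => //; first by lra.
have deta : d * (4 + ln k%:R) <= eta.
  by rewrite -ler_pdivlMr// ge_min lexx orbT.
have lnd : d * - ln d <= 1.
  rewrite -lnV ?posrE// -ler_pdivlMl// mulr1 ltW//.
  by apply: ln_sublinear; rewrite invr_gt0.
have ln1 : - ln (1 - d * d) <= 2 * (d * d).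
  rewrite -lnV ?posrE; last by lra.
  have -> : (1 - d * d)^-1 = 1 + ((1 - d * d)^-1 - 1) by lra.
  apply: le_trans (le_ln1Dx _) _.
    by rewrite ltrBrDr addNr invr_gt0; lra.
  rewrite lerBlDr -div1r ler_pdivrMr; last by lra.
  have : d * d * (d * d) <= 2^-1 * (d * d) by rewrite ler_pM2r.
  lra.
rewrite ln_div ?posrE// lnM ?posrE//.
have dlnd : d * d * - ln d <= d.
  by rewrite -mulrA -[leRHS]mulr1 ler_pM2l.
have : d * d * ln k%:R <= d * ln k%:R by rewrite ler_wpM2r//; lra.
lra.
Qed.

(** After division by n the m boundary letters contribute nothing in the limit, and the cost of
    predicting labels from finitely many coordinates is arbitrarily small. *)
Lemma entropy_le : (entropy f mu <= coord_cost%:E)%E.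
Proof.
apply: ge_ereal_sup => _ [k [xi [mxi ->]]]; rewrite lee_fin.
(* For a divergent sequence [limn] takes the default value 0. *)
have [cvgH|/dvgP->] :=
  pselect (cvgn (fun n => partition_entropy f mu xi n / n%:R));
  last exact: coord_cost_ge0.
have k0 : (0 < k)%N by apply: leq_ltn_trans (ltn_ord (xi point)).
apply/ler_addgt0Pr => eta eta0.
have eta20 : 0 < eta / 2 by rewrite divr_gt0.
have [e [e0 e1 ee]] := prediction_cost k0 eta20.
have [m [theta [mtheta mis]]] := partition_approx mu mxi e0.
apply: limr_le => //; near=> n.
have n0 : (0 : R) < n%:R by rewrite ltr0n; near: n; exists 1%N.
rewrite ler_pdivrMr//.
apply: le_trans (partition_entropy_le n mxi mtheta mis e0 e1) _.
have : n%:R * (e * - ln (e / k%:R) - ln (1 - e)) <= n%:R * (eta / 2).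
  by rewrite ler_wpM2l// ltW.
have : m%:R * coord_cost <= n%:R * (eta / 2).
  rewrite -ler_pdivrMr//; near: n; exact: nbhs_infty_ger.
rewrite natrD; lra.
Unshelve. all: by end_near. Qed.

End shift_entropy.

(** * The density of letters *)

Section coboundary.
Context {R : realType} (B : alphabetType).
Local Notation T := (fullshift R B).
Local Notation f := (@shift_map R B).
Variables (mu : probability (borel T) R).
Hypothesis mu_inv : shift_invariant mu.

(** For F depending only on the first m coordinates this is the integral of F, written as a finite
    sum. *)
Definition expect m (F : T -> R) : R :=
  \sum_w law mu (@word R B m : borel T -> _) w * F (extend w).

Lemma expect_widen m n (F : T -> R) : (m <= n)%N -> fdim_fun m F ->
  expect n F = expect m F.
Proof.
move=> mn mF; pose h (w : {ffun 'I_n -> B}) := word m (@extend R B n w).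
rewrite /expect; have -> : (@word R B m : borel T -> _) = h \o @word R B n.
  apply/funext => x; apply/ffunP => i; rewrite !ffunE extend_word//.
  exact: leq_trans mn.
rewrite expect_comp; last exact: finite_valued_word.
apply: eq_bigr => w _; congr (_ * _); apply: mF; apply: agree_sym.
exact: extend_word.
Qed.

Lemma expect_shift m (F : T -> R) : fdim_fun m F ->
  expect m.+1 (F \o f) = expect m F.
Proof.
move=> mF; pose h (w : {ffun 'I_m.+1 -> B}) := word m (f (@extend R B _ w)).
rewrite /expect -[in RHS](law_iter 1%N mu_inv (@finite_valued_word R B m)).
have -> : (@word R B m : T -> _) \o iter 1%N f = h \o @word R B m.+1.
  apply/funext => x; apply/ffunP => i; rewrite !ffunE/=.
  by rewrite /shift_map extend_word// ltnS.
rewrite expect_comp; last exact: finite_valued_word.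
apply: eq_bigr => w _; congr (_ * _); apply: mF; apply: agree_sym.
exact: extend_word.
Qed.

Lemma expect_pred m (P : T -> bool) : fdim_fun m P ->
  expect m (fun x => (P x)%:R) = fine (mu [set x | P x]).
Proof.
move=> mP.
have -> : [set x | P x] =
    (@word R B m : borel T -> _) @^-1` [set w | P (extend w)].
  apply/seteqP; split=> x /=; rewrite -(mP x)//; apply: agree_sym;
    exact: extend_word.
rewrite law_pred; last exact: finite_valued_word.
rewrite [RHS]big_mkcond; apply: eq_bigr => w _.
by case: (P _); rewrite ?mulr1 ?mulr0.
Qed.

(** By invariance a coboundary has mean zero. The pointwise inequality on X suffices, since a word
    of positive probability occurs at the start of some point of X. *)
Lemma coboundary_le0 m (X : set T) (u phi : T -> R) :
  measurable (X : set (borel T)) -> mu X = 1%E ->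
  fdim_fun m.+1 u -> fdim_fun m phi ->
  (forall x, X x -> u x <= phi x - phi (f x)) -> expect m.+1 u <= 0.
Proof.
move=> mX X1 mu' mphi h.
suff : expect m.+1 u <= expect m.+1 phi - expect m.+1 (phi \o f).
  by rewrite expect_shift// (expect_widen (leqnSn m) mphi) subrr.
rewrite /expect -sumrB; apply: ler_sum => w _; rewrite -mulrBr.
set p := law _ _ _; have p0 : 0 <= p by exact: law_ge0.
have [->|pn0] := eqVneq p 0; first by rewrite !mul0r.
have [x [Xx xw]] : exists x, X x /\ word m.+1 x = w.
  apply: contrapT => /forallNP nx; move/eqP: pn0; apply.
  suff : (mu ((@word R B m.+1 : borel T -> _) @^-1` [set w]) <= 0)%E.
    rewrite measure_le0 => /eqP H; by rewrite /p /law H.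
  have <- : mu (~` X) = 0%E by rewrite probability_setC// X1 subee.
  apply: le_measure; rewrite ?inE.
  - exact: finite_valued_word.
  - exact: measurableC.
  - by move=> x /= xw Xx; apply: (nx x).
have xe : agree m.+1 (extend w) x by rewrite -xw; exact: extend_word.
rewrite ler_wpM2l//= (mu' _ _ xe) (mphi _ _ (agree_le (leqnSn m) xe)).
rewrite (mphi _ _ (agree_shift_map xe)); exact: h.
Qed.

End coboundary.

(** * Lengths of initial runs, capped at n *)

Fixpoint lead (p : pred nat) n :=
  if n is n'.+1 then if p 0%N then (lead (p \o succn) n').+1 else 0%N else 0%N.

Lemma lead_prefix (p : pred nat) n k : (k < lead p n)%N -> p k.
Proof.
elim: n p k => //= n ih p k; case: ifP => // p0.
by case: k => // k; rewrite ltnS => /ih.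
Qed.

Lemma lead_stop (p : pred nat) n : (lead p n < n)%N -> ~~ p (lead p n).
Proof. by elim: n p => //= n ih p; case: ifP => [_ /ih|->]. Qed.

Lemma lead_stable (p : pred nat) n : (lead p n < n)%N -> lead p n.+1 = lead p n.
Proof.
by elim: n p => //= n ih p; case: ifP => // p0; rewrite ltnS => /ih ->.
Qed.

Lemma lead_leS (p : pred nat) n : (lead p n <= lead p n.+1)%N.
Proof. by elim: n p => //= n ih p; case: ifP => // p0; rewrite ltnS. Qed.

Lemma lead_ge (p : pred nat) n d :
  (d <= n)%N -> (forall k, (k < d)%N -> p k) -> (d <= lead p n)%N.
Proof.
elim: n p d => [|n ih] p [|d]//= dn h; rewrite h// ltnS ih// => k kd.
exact: (h k.+1).
Qed.

Lemma eq_lead (p p' : pred nat) n :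
  (forall k, (k < n)%N -> p k = p' k) -> lead p n = lead p' n.
Proof.
elim: n p p' => //= n ih p p' h; rewrite h//; case: ifP => // _.
by congr _.+1; apply: ih => k kn; exact: (h k.+1).
Qed.

Lemma density_le (R : realType) (t a : R) :
  0 < t -> t * a - (1 - a) <= 0 -> a <= (1 + t)^-1.
Proof. by move=> t0 h; rewrite -div1r ler_pdivlMr; lra. Qed.

(** Declared so that the finite and pointed structures of [option A] combine into an
    [alphabetType]. *)
HB.instance Definition _ (A : finType) := Finite.on (option A).

(** * The density bound on the gap shift *)

Section star_density.
Context {R : realType} (A : finType) (Z : set (fullshift R A)) (g : nat -> nat).
Variable t : R.
Hypotheses (subZ : subshift Z) (t_gt0 : 0 < t).
Hypothesis (tg : forall n, t * n%:R <= (g n)%:R).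
Local Notation T := (fullshift R (option A)).
Local Notation f := (@shift_map R (option A)).
Local Notation X := (gap_shift Z g).
Local Notation ZB := (recode Some @` Z).
Variables (mu : probability (borel T) R).
Hypotheses (mu_inv : shift_invariant mu) (muX : mu X = 1%E) (muZ : mu ZB = 0%E).

(** The initial run of letters, capped at K.+1, and the run of stars after it, capped at J. The caps
    keep [credit] dependent on finitely many coordinates. *)
Let d K (x : T) := lead (fun i => x i) K.+1.
Let j K J (x : T) := lead (fun i => ~~ x (d K x + i)%N) J.

(* A run of d letters before l stars gets credit t d - min(l, J), which is
   nonpositive on X; moving along a point of X, it drops by t at a letter and
   rises by at most 1 at a star. *)
Let credit K J (x : T) : R :=
  if (d K x <= K)%N then t * (d K x)%:R - (j K J x)%:R else 0.

Let fdim_credit K J : fdim_fun (K.+1 + J) (credit K J).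
Proof.
move=> x y xy; have dE : d K x = d K y.
  by apply: eq_lead => k kK; rewrite xy//; lia.
rewrite /credit -dE; case: ifP => // dK; congr (_ - _%:R).
by apply: eq_lead => k kJ; rewrite -dE xy//; lia.
Qed.

(** The d letters are followed by at least g d >= t d stars; since J >= t K >= t d, capping the
    count at J loses nothing. *)
Let credit_le0 K J x : t * K%:R <= J%:R -> X x -> credit K J x <= 0.
Proof.
move=> tKJ Xx; rewrite /credit; case: ifP => // dK; rewrite subr_le0.
have [->|d0] := posnP (d K x); first by rewrite mulr0.
have b : block x 0 (d K x).
  by move=> k /lead_prefix; rewrite add0n; case: (x k).
have xd : x (d K x) = None.
  by have := @lead_stop (fun i => x i) K.+1 dK; rewrite -/(d K x); case: (x _).
have [_ /(_ d0)] := Xx 0%N _ b; rewrite add0n => /(_ xd) star.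
apply: (@le_trans _ _ (minn (g (d K x)) J)%:R); last first.
  rewrite ler_nat; apply: lead_ge => [|k]; first exact: geq_minr.
  by rewrite leq_min => /andP[/star->].
rewrite natr_min le_min tg/=; apply: le_trans tKJ.
by rewrite ler_pM2l// ler_nat.
Qed.

(** The term with K.+1 <= d K x is the error made by giving no credit to runs of more than K
    letters. *)
Let credit_step K J x : t * K%:R <= J%:R -> X x ->
  t * (x 0%N : bool)%:R - (~~ x 0%N)%:R - t * (K.+1 <= d K x)%N%:R
    <= credit K J x - credit K J (f x).
Proof.
move=> tKJ Xx; have := credit_le0 tKJ (@gap_shift_shift _ _ _ _ x 1%N Xx).
rewrite -/(f x) => cfx.
case x0: (x 0%N) => [a|] /=.
  (* In a run longer than K the error term cancels the weight of the letter, the credit of x is 0,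
     and that of f x is nonpositive. *)
  rewrite mulr1 subr0; have [dK|dK] := ltnP K (d K x).
    by rewrite mulr1 subrr {1}/credit leqNgt dK /= sub0r oppr_ge0.
  rewrite mulr0 subr0.
  have dE : d K x = (d K (f x)).+1.
    rewrite /d/= x0; congr _.+1; rewrite -[RHS]/(lead (fun i => x i.+1) K.+1).
    by rewrite lead_stable//; move: dK; rewrite /d/= x0.
  rewrite /credit dK (_ : (d K (f x) <= K)%N); last by lia.
  have -> : j K J (f x) = j K J x.
    by apply: eq_lead => k kJ; rewrite /shift_map dE addSn.
  by rewrite dE -[in leRHS]natr1; lra.
have dx : d K x = 0%N by rewrite /d/= x0.
rewrite mulr0 dx ltn0 mulr0 subr0 sub0r {1}/credit dx leq0n mulr0 sub0r.
suff : (j K J x)%:R <= 1 - credit K J (f x) :> R by lra.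
(* If a letter follows, the run of stars has length at most 1; if a star follows, the shift shortens
   the run by at most 1. *)
case x1: (x 1%N) => [a|].
  apply: (@le_trans _ _ 1); last by lra.
  rewrite (_ : 1 = 1%:R)// ler_nat /j dx; case: (J) => //= J'.
  rewrite add0n x0/=; case: J' => // J'; by rewrite /= add0n x1.
have dfx : d K (f x) = 0%N by rewrite /d/= /shift_map x1.
rewrite /credit dfx leq0n mulr0 sub0r opprK addrC natr1 ler_nat.
rewrite /j dx dfx; case: (J) => // J' /=; rewrite add0n x0 /= ltnS.
exact: lead_leS.
Qed.

Lemma expectB (m : nat) (F G : T -> R) :
  expect mu m (fun x => F x - G x) = expect mu m F - expect mu m G.
Proof. by rewrite /expect -sumrB; apply: eq_bigr => w _; rewrite mulrBr. Qed.

Lemma expectZ (m : nat) c (F : T -> R) :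
  expect mu m (fun x => c * F x) = c * expect mu m F.
Proof. by rewrite /expect mulr_sumr; apply: eq_bigr => w _; rewrite mulrCA. Qed.

Let letter_star K :
  t * fine (mu [set x | x 0%N]) - fine (mu [set x | ~~ x 0%N])
    <= t * fine (mu [set x | (K.+1 <= d K x)%N]).
Proof.
have [J tKJ] : exists J, t * K%:R <= J%:R.
  by exists (Num.bound (t * K%:R)); apply/ltW/archi_boundP;
    rewrite mulr_ge0// ltW.
have mX : measurable (X : set (borel T)).
  exact: measurable_closed (@closed_gap_shift R A Z g).
pose u (x : T) : R :=
  t * (x 0%N : bool)%:R - (~~ x 0%N)%:R - t * (K.+1 <= d K x)%N%:R.
have dE (x y : T) : agree (K.+1 + J).+1 x y -> d K x = d K y.
  by move=> xy; apply: eq_lead => k kK; rewrite xy//; lia.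
have mu_u : fdim_fun (K.+1 + J).+1 u.
  by move=> x y xy; rewrite /u (dE _ _ xy) xy.
have := coboundary_le0 mu_inv mX muX mu_u (@fdim_credit K J)
  (fun x Xx => credit_step tKJ Xx).
rewrite /u !expectB !expectZ !expect_pred; [by lra|..].
all: move=> x y xy; first [by rewrite xy|congr (_ <= _)%N; exact: dE].
Qed.

(** As K grows, the error term in [letter_star] tends to t times the mass of the points without
    stars, which on X are the points of ZB and form a null set. *)
Lemma letter_density : fine (mu [set x : T | x 0%N]) <= (1 + t)^-1.
Proof.
have mA : measurable ([set x : T | x 0%N] : set (borel T)).
  exact: measurable_fin_dim (fin_dim_coord 0%N isSome).
have starE : fine (mu [set x | ~~ x 0%N]) = 1 - fine (mu [set x : T | x 0%N]).
  rewrite -[X in mu X](_ : ~` [set x : T | x 0%N] = _); last first.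
    by apply/seteqP; split=> x /= /negP.
  by rewrite probability_setC// fineB// fin_num_measure.
suff h : t * fine (mu [set x : T | x 0%N]) - fine (mu [set x | ~~ x 0%N]) <= 0.
  by rewrite starE in h; exact: density_le h.
pose D K : set (borel T) := [set x | (K.+1 <= d K x)%N].
have DE K x : D K x <-> forall k, (k <= K)%N -> x k.
  split=> [Dx k kK|h]; last by apply: lead_ge.
  by apply: (@lead_prefix (fun i => x i) K.+1); exact: leq_trans Dx.
have mD K : measurable (D K).
  apply: measurable_fin_dim; exists K.+1 => x y xy /DE h; apply/DE => k kK.
  by rewrite -xy//; exact: h.
have mX : measurable (X : set (borel T)).
  exact: measurable_closed (@closed_gap_shift R A Z g).
have mZ : measurable (ZB : set (borel T)).
  exact: measurable_closed (closed_recode g subZ).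
have D0 : mu (\bigcap_K D K) = 0%E.
  apply/eqP; rewrite -measure_le0.
  have -> : 0%E = (mu ZB + mu (~` X))%E :> \bar R.
    by rewrite muZ probability_setC// muX subee// add0e.
  apply: le_trans (measureU2 _ _ _) => //; last exact: measurableC.
  apply: le_measure; rewrite ?inE.
  - exact: bigcapT_measurable.
  - by apply: measurableU => //; exact: measurableC.
  - move=> x Dx; have [Xx|] := pselect (X x); last by right.
    left; apply: (recode_mem subZ Xx) => k; have /DE := Dx k I.
    by move=> /(_ k (leqnn _)); case: (x k).
have cvgD : mu \o D @ \oo --> 0%E.
  rewrite -D0; apply: nonincreasing_cvg_mu => //.
  - by apply: le_lt_trans (probability_le1 _ _) (ltry _).
  - exact: bigcapT_measurable.
  - move=> m n mn; apply/subsetPset => x /DE h; apply/DE => k km.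
    by apply: h; exact: leq_trans mn.
have /fine_cvgP[_ cvgfD] := cvgD.
have tcvg : (fun K => t * fine (mu (D K))) @ \oo --> 0.
  by rewrite -(mulr0 t); apply: cvgMr.
rewrite -(cvg_lim _ tcvg)//; apply: limr_ge; first by apply/cvg_ex; exists 0.
by apply: nearW => K; exact: letter_star.
Qed.

End star_density.

(** * Weak-star convergence *)

Lemma initial_cvg (S : choiceType) (U : topologicalType) (h : S -> U)
    (F : set_system S) (s : S) : Filter F ->
  h @ F --> h s -> F --> (s : initial_topology h).
Proof.
move=> FF hF A /= [V [VO Vs VA]]; case: VO Vs VA => O oO <- Os OA.
by apply: filterS OA _; apply: hF; exact: open_nbhs_nbhs.
Qed.

Lemma prod_cvg (I : Type) (K : I -> topologicalType)
    (F : set_system (prod_topology K))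
    (s : prod_topology K) : Filter F ->
  (forall i, (fun h : prod_topology K => h i) @ F --> s i) -> F --> s.
Proof.
move=> FF h; apply/cvg_sup => i.
exact: (@initial_cvg _ _ (fun h : prod_topology K => h i)).
Qed.

Section weak_star.
Context {R : realType} (T : ptopologicalType).

Definition integral_of (phi : continuousType T R) (mu : weak_star R T) : R :=
  \int[mu : probability (borel T) R]_x phi x.

Lemma integral_of_continuous phi : continuous (integral_of phi).
Proof.
pose K : continuousType T R -> topologicalType := fun=> R.
pose h (mu : probability (borel T) R) : prod_topology K :=
  fun phi : continuousType T R => \int[mu]_x phi x.
move=> mu; apply: (@continuous_comp (weak_star R T) _ _ h (@proj _ K phi)).
  exact: (@initial_continuous _ _ h).
exact: proj_continuous.
Qed.

Lemma weak_star_cvg (F : set_system (weak_star R T)) (mu : weak_star R T) :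
  Filter F -> (forall phi, integral_of phi @ F --> integral_of phi mu) ->
  F --> mu.
Proof.
move=> FF h; apply: initial_cvg; apply: prod_cvg => phi; exact: h.
Qed.

End weak_star.

(** * Integrals of continuous functions on the full shift *)

Section shift_integrals.
Context {R : realType} (B : alphabetType).
Local Notation T := (fullshift R B).
Local Notation f := (@shift_map R B).

Local Notation word := (@word R B).

Lemma Rintegral_fdim (mu : probability (borel T) R) m (F : T -> R) :
  fdim_fun m F ->
  mu.-integrable setT (EFin \o F) /\ \int[mu]_x F x = expect mu m F.
Proof.
move=> mF; pose W : borel T -> {ffun 'I_m -> B} := word m.
have mW : finite_valued W by exact: finite_valued_word.
have FE x : F x = \sum_w F (extend w) * \1_(W @^-1` [set w]) x.
  rewrite (bigD1 (word m x))//= big1 ?addr0.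
    rewrite indicE mem_set// mulr1; apply: mF; apply: agree_sym.
    exact: extend_word.
  move=> w wx; rewrite indicE memNset ?mulr0//= => wE.
  by rewrite -wE eqxx in wx.
have fE : EFin \o F =
   (fun x => \sum_w ((F (extend w))%:E * (\1_(W @^-1` [set w]) x)%:E))%E.
  by apply/funext => x /=; rewrite FE -sumEFin.
have m1 w : mu.-integrable setT (fun x => (\1_(W @^-1` [set w]) x)%:E : \bar R).
  by apply: integrable_indic => //; exact: mW.
have mi w : mu.-integrable setT
    (fun x => (F (extend w))%:E * (\1_(W @^-1` [set w]) x)%:E)%E.
  exact: integrableZl.
split; first by rewrite fE; exact: integrable_sum.
have -> : \int[mu]_x F x = fine (\int[mu]_x (\sum_w ((F (extend w))%:E *
    (\1_(W @^-1` [set w]) x)%:E)))%E.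
  by rewrite /Rintegral -fE.
rewrite integral_sum//= (eq_bigr (fun w => (law mu W w * F (extend w))%:E)).
  by rewrite sumEFin.
move=> w _; rewrite integralZl// integral_indic// setIT.
rewrite -[X in (_ * X)%E]fineK ?fin_num_measure//.
by rewrite -EFinM mulrC.
Qed.

Lemma continuous_fdim_fun m (F : T -> R) : fdim_fun m F -> continuous F.
Proof.
move=> mF x U /nbhs_singleton Ux; apply/nbhs_agreeP; exists m => y xy.
by rewrite /= -(mF _ _ xy).
Qed.

(** Uniform continuity: bad pairs agreeing on ever longer prefixes would have a cluster point, where
    continuity fails. *)
Lemma uniform_fdim (phi : T -> R) (e : R) : continuous phi -> 0 < e ->
  exists m, forall x y, agree m x y -> `|phi x - phi y| <= e.
Proof.
move=> cphi e0; apply: contrapT => /forallNP nm.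
have /choice[u hu] m : exists x : T * T,
    agree m x.1 x.2 /\ e < `|phi x.1 - phi x.2|.
  have /existsNP[x /existsNP[y /not_implyP[xy ne]]] := nm m.
  by exists (x, y); split=> //; rewrite ltNge; apply/negP.
have [] := @fullshift_compact R B ((fun m => (u m).1) @ \oo) _ _.
  exact: filterT.
move=> p [_ clp].
have e20 : 0 < e / 2 by rewrite divr_gt0.
have := cphi p; move/cvgrPdist_lt => /(_ _ e20)/nbhs_agreeP[n nphi].
have /(_ _ _)[||x [[m /= nm' <-] px]] :=
  clp [set (u m).1 | m in [set m | (n <= m)%N]]
    [set y | agree n p y].
- by exists n => // m /= nm'; exists m.
- by apply/nbhs_agreeP; exists n.
have [umm eu] := hu m.
have := nphi _ px.
have := nphi _ (agree_trans px (agree_le nm' umm)).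
move=> /= h1 h2; move: eu; rewrite ltNge => /negP; apply.
rewrite [leRHS]splitr; apply: le_trans (lerD (ltW h2) (ltW h1)).
rewrite [X in _ <= X + _]distrC; apply: le_trans (ler_normD _ _).
by rewrite subrKA.
Qed.

Lemma integrable_continuous (mu : probability (borel T) R) (phi : T -> R) :
  continuous phi -> mu.-integrable setT (EFin \o (phi : borel T -> R)).
Proof.
move=> cphi; apply: measurable_bounded_integrable => //.
- by rewrite ltey_eq fin_num_measure.
- apply: (measurability _ (measurable_realfun.RGenOpens.measurableE R)).
  move=> _ [_ [a [b ->] <-]]; rewrite setTI; apply: measurable_open.
  by move/continuousP: cphi; apply; exact: interval_open.
- have [m mphi] := uniform_fdim cphi ltr01.
  (* Up to an error of 1, phi takes only its values at the finitely many padded words, and the sum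
     of their absolute values bounds them all. *)
  exists (1 + \sum_(w : {ffun 'I_m -> B}) `|phi (extend w)|); split.
    by rewrite num_real.
  move=> M hM x _; apply: le_trans (ltW hM).
  have /mphi := @extend_word R B m x; rewrite distrC => h.
  have -> : phi x = (phi x - phi (extend (word m x))) + phi (extend (word m x)).
    by rewrite subrK.
  apply: le_trans (ler_normD _ _) _; apply: lerD => //.
  by rewrite (bigD1 (word m x))//= lerDl; apply: sumr_ge0.
Qed.

(** A three-epsilon argument: phi is uniformly e / 3-close to a function of finitely many
    coordinates, whose integral is a finite combination of cylinder measures. *)
Lemma weak_star_fin_dim_cvg (F : set_system (weak_star R T))
    (mu : weak_star R T) :
  Filter F ->
  (forall C, fin_dim C -> (fun nu : probability (borel T) R => fine (nu C)) @ F
     --> fine ((mu : probability (borel T) R) C)) ->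
  F --> mu.
Proof.
move=> FF h; apply: weak_star_cvg => phi; apply/cvgrPdist_le => e e0.
have e30 : 0 < e / 3 by rewrite divr_gt0.
have [m mphi] := uniform_fdim (@cts_fun _ _ phi) e30.
pose phim (x : T) : R := phi (extend (word m x)).
have phimm : fdim_fun m phim.
  move=> x y xy; rewrite /phim; congr (phi (extend _)).
  by apply/ffunP => i; rewrite !ffunE xy.
have close (nu : probability (borel T) R) :
    `|\int[nu]_x phi x - expect nu m phim| <= e / 3.
  have [inu <-] := Rintegral_fdim nu phimm.
  have iphi := integrable_continuous nu (@cts_fun _ _ phi).
  rewrite -RintegralB//; apply: le_trans (le_normr_Rintegral _ _) _ => //.
    by rewrite (_ : _ \o _ = (EFin \o phi) \- (EFin \o phim))%E//;
      exact: integrableB.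
  apply: (@le_trans _ _ (\int[nu]_x (fun=> e / 3) x)).
    apply: le_Rintegral => //.
    - by have := integrable_norm (integrableB measurableT iphi inu).
    - exact: finite_measure_integrable_cst.
    - by move=> x _; apply: mphi; apply: agree_sym; exact: extend_word.
  rewrite Rintegral_cst// (_ : fine _ = 1) ?mulr1//.
  by rewrite [X in fine X](_ : _ = 1%E)//; exact: probability_setT.
have cvgE : (fun nu : weak_star R T =>
  expect (nu : probability _ _) m phim) @ F -->
    expect (mu : probability _ _) m phim.
  apply: cvg_big => [|w _]; first exact: add_continuous.
  apply: cvgMl; apply: h; exists m => x y xy /= <-.
  by apply/ffunP => i; rewrite !ffunE xy.
have /cvgrPdist_le /(_ _ e30) := cvgE.
apply: filterS => nu nuE.
rewrite /integral_of; have := close mu; have := close nu.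
set a := \int[_]_x _; set b := \int[_]_x _ => cn cm.
have -> : e = e / 3 + e / 3 + e / 3 by lra.
have -> : b - a = (b - expect (mu : probability _ _) m phim) +
  (expect (mu : probability _ _) m phim -
   expect (nu : probability _ _) m phim) +
  (expect (nu : probability _ _) m phim - a) by lra.
apply: le_trans (ler_normD _ _) _; rewrite lerD//; last by rewrite distrC.
by apply: le_trans (ler_normD _ _) _; rewrite lerD.
Qed.

(** The indicator of a finite-dimensional set is continuous, so its integral is one of the maps
    defining the topology. *)
Lemma measure_continuous C : fin_dim C ->
  continuous (fun mu : weak_star R T =>
    fine ((mu : probability (borel T) R) C)).
Proof.
move=> [m mC].
have mI : fdim_fun m (\1_C : T -> R).
  move=> x y xy; rewrite !indicE; suff -> : (x \in C) = (y \in C) by [].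
  by apply/idP/idP; rewrite !inE; apply: mC => //; exact: agree_sym.
pose phi : continuousType T R := HB.pack (\1_C : T -> R)
  (@isContinuous.Build T R (\1_C : T -> R) (continuous_fdim_fun mI)).
have -> : (fun mu : weak_star R T => fine ((mu : probability (borel T) R) C)) =
    integral_of phi.
  apply/funext => mu; rewrite /integral_of /Rintegral/= integral_indic ?setIT//.
  by apply: measurable_fin_dim; exists m.
exact: integral_of_continuous.
Qed.

End shift_integrals.

(** * Extending finitely additive measures *)

Definition fin_dim_display : measure_display.
Proof. exact: default_measure_display. Qed.

(* The full shift equipped with the algebra, not the sigma-algebra, of its
   finite-dimensional sets. *)
Definition fin_dim_type (R : realType) (B : alphabetType) : Type :=
  fullshift R B.

HB.instance Definition _ (R : realType) (B : alphabetType) :=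
  Pointed.copy (fin_dim_type R B) (fullshift R B).

HB.instance Definition _ (R : realType) (B : alphabetType) :=
  isAlgebraOfSets.Build fin_dim_display (fin_dim_type R B)
    (@fin_dim0 R B) (@fin_dimU R B) (@fin_dimC R B).

Section fin_dim_extension.
Context {R : realType} (B : alphabetType).
Local Notation T := (fullshift R B).
Variable c : set T -> R.
Hypotheses (c_ge0 : forall C, 0 <= c C) (cT : c setT = 1).
Hypothesis cU : forall C D, fin_dim C -> fin_dim D -> C `&` D = set0 ->
  c (C `|` D) = c C + c D.

(** Points escaping all finite unions would cluster, by compactness, at a point of some open F k,
    which they eventually avoid. This turns finite additivity into countable additivity. *)
Lemma fin_dim_bigcup (F : (set T)^nat) :
  (forall k, fin_dim (F k)) -> fin_dim (\bigcup_k F k) ->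
  exists N, \bigcup_k F k = \big[setU/set0]_(k < N) F k.
Proof.
move=> fF fU; apply: contrapT => /forallNP nN.
have /choice[u hu] N : exists x, (\bigcup_k F k) x /\
    ~ (\big[setU/set0]_(k < N) F k) x.
  apply: contrapT => /forallNP h; apply: (nN N); apply/seteqP; split => x.
    by move=> Ux; apply: contrapT => nx; exact: (h x).
  by rewrite -bigcup_mkord => -[k _ Fx]; exists k.
have cpt := closed_compact (closed_fin_dim fU).
have [] := cpt (u @ \oo) _.
  by exists 0%N => // N _; have [] := hu N.
move=> p [[k _ Fkp] clp].
have [||x [[N /= kN <-] FuN]] := clp [set u N | N in [set N | (k < N)%N]] (F k).
- by exists k.+1 => // N /= kN; exists N.
- exact: open_nbhs_nbhs (conj (open_fin_dim (fF k)) Fkp).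
have [_] := hu N; apply; rewrite -bigcup_mkord.
by exists k.
Qed.

Let c0 : c set0 = 0.
Proof.
have := cU (@fin_dimT R B) (@fin_dim0 R B) (setI0 _).
by rewrite setU0 => /eqP; rewrite -subr_eq0 opprD addrA subrr sub0r oppr_eq0 =>
  /eqP.
Qed.

Definition fin_dim_content (C : set (fin_dim_type R B)) : \bar R := (c C)%:E.

Let content0 : fin_dim_content set0 = 0%E.
Proof. by rewrite /fin_dim_content c0. Qed.

Let content_ge0 C : (0 <= fin_dim_content C)%E. Proof. by rewrite lee_fin. Qed.

Let content_bigsetU (F : (set T)^nat) n : (forall k, fin_dim (F k)) ->
  trivIset setT F ->
  fin_dim (\big[setU/set0]_(k < n) F k) /\
  c (\big[setU/set0]_(k < n) F k) = \sum_(k < n) c (F k).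
Proof.
move=> fF tF; elim: n => [|n [fn cn]].
  by rewrite !big_ord0; split => //; exact: fin_dim0.
rewrite !big_ord_recr/=; split; first exact: fin_dimU.
rewrite cU ?cn//; rewrite -bigcup_mkord -subset0 => x [[k /= kn Fk] Fn].
suff E : k = n by rewrite E ltnn in kn.
by apply: (tF k n) => //; exists x.
Qed.

Let content_sigma_additive : semi_sigma_additive fin_dim_content.
Proof.
move=> F mF tF mU; have [N UN] := fin_dim_bigcup mF mU.
(* By disjointness the members from N on are empty, and the series is eventually constant. *)
have F0 k : (N <= k)%N -> F k = set0.
  move=> Nk; rewrite -subset0 => x Fkx.
  have : (\bigcup_k F k) x by exists k.
  rewrite UN -bigcup_mkord => -[l /= lN Flx].
  suff E : k = l by rewrite E leqNgt lN in Nk.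
  by apply: (tF k l) => //; exists x.
apply: cvg_near_cst; exists N => // n /= Nn.
rewrite /fin_dim_content sumEFin big_mkord; congr EFin.
have [_ <-] := content_bigsetU n mF tF; congr c; rewrite UN.
rewrite -!bigcup_mkord; apply/seteqP; split=> x [k /= kn Fkx]; exists k => //=.
  by rewrite ltnNge; apply/negP => /F0 E; rewrite E in Fkx.
exact: leq_trans Nn.
Qed.

HB.instance Definition _ := isMeasure.Build fin_dim_display _ _ fin_dim_content
  content0 content_ge0 content_sigma_additive.

Definition fin_dim_extension : set (borel T) -> \bar R :=
  measure_extension fin_dim_content.

Let borelE : @measurable _ (borel T) =
  @measurable _ (g_sigma_algebraType (@measurable _ (fin_dim_type R B))).
Proof. exact: measurable_fin_dimE. Qed.

Let extension0 : fin_dim_extension set0 = 0%E.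
Proof. exact: (measure0 (measure_extension fin_dim_content)). Qed.

Let extension_ge0 E : (0 <= fin_dim_extension E)%E.
Proof. exact: (measure_ge0 (measure_extension fin_dim_content)). Qed.

Let extension_sigma_additive : semi_sigma_additive fin_dim_extension.
Proof.
rewrite /semi_sigma_additive borelE => F mF tF mU.
exact: (measure_semi_sigma_additive (s := measure_extension fin_dim_content)).
Qed.

HB.instance Definition _ := isMeasure.Build _ _ _ fin_dim_extension
  extension0 extension_ge0 extension_sigma_additive.

Lemma fin_dim_extensionE C : fin_dim C -> fin_dim_extension C = (c C)%:E.
Proof.
move=> fC; exact: (@measurable_mu_extE _ R (fin_dim_type R B) fin_dim_content).
Qed.

Let extensionT : fin_dim_extension setT = 1%E.
Proof. by rewrite fin_dim_extensionE ?cT//; exact: fin_dimT. Qed.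

HB.instance Definition _ := Measure_isProbability.Build _ _ _ fin_dim_extension
  extensionT.

Lemma ex_fin_dim_probability : exists mu : probability (borel T) R,
  forall C, fin_dim C -> mu C = (c C)%:E.
Proof. by exists fin_dim_extension => C; exact: fin_dim_extensionE. Qed.

End fin_dim_extension.

(** * Empirical measures *)

Section empirical_measures.
Context {R : realType} (B : alphabetType).
Local Notation T := (fullshift R B).
Local Notation f := (@shift_map R B).
Implicit Types (x y : T) (E C X : set T).

Lemma empiricalE x n (E : set (borel T)) : @empirical R T f x n E =
  (n.+1%:R^-1 * \sum_(k < n.+1) (iter k f x \in E)%:R)%:E.
Proof.
rewrite /empirical /mscale /msum/= EFinM -sumEFin; congr (_ * _)%E.
Qed.

(** Only the last m times can see coordinates at which x and y differ. *)
Lemma empirical_agree m n x y C : fdim m C -> agree n.+1 x y ->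
  `|fine (@empirical R T f x n C) - fine (@empirical R T f y n C)|
    <= m%:R / n.+1%:R.
Proof.
move=> mC xy; rewrite !empiricalE/= -mulrBr -sumrB normrM ger0_norm ?invr_ge0//.
rewrite mulrC ler_pM2r ?invr_gt0//.
have EC k : (k + m <= n.+1)%N -> (iter k f x \in C) = (iter k f y \in C).
  move=> km; have kxy : agree m (iter k f x) (iter k f y).
    by move=> j jm; rewrite !iter_shift_mapE xy//; lia.
  by apply/idP/idP; rewrite !inE; apply: mC => //; exact: agree_sym.
apply: le_trans (ler_norm_sum _ _ _) _.
apply: (@le_trans _ _ (\sum_(k < n.+1) (n.+1 - m <= k)%N%:R)).
  apply: ler_sum => k _; have [km|km] := leqP (n.+1 - m) k.
    by case: (_ \in _); case: (_ \in _);
      rewrite ?subrr ?subr0 ?sub0r ?normrN ?normr1 ?normr0.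
  by rewrite EC ?subrr ?normr0//; lia.
have -> N : \sum_(k < N) (n.+1 - m <= k)%N%:R = (N - (n.+1 - m))%:R :> R.
  elim: N => [|N ih]; first by rewrite big_ord0.
  rewrite big_ord_recr/= ih -natrD; congr (_%:R).
  by case: (leqP (n.+1 - m) N); lia.
by rewrite ler_nat; lia.
Qed.

Lemma iter_periodic y p : (forall i, y (i + p)%N = y i) -> iter p f y = y.
Proof. by move=> yp; apply/funext => i; rewrite iter_shift_mapE addnC yp. Qed.

(** An invariant set contains all or none of a periodic orbit. The period is n.+1 because
    [empirical] averages over n.+1 points. *)
Lemma ergodic_periodic X y n : closed X -> f @` X `<=` X -> X y ->
  iter n.+1 f y = y ->
  ergodic_measures f X (@empirical R T f y n : weak_star R T).
Proof.
move=> cX fX Xy yp; split.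
- change (@empirical R T f y n X = 1%E).
  rewrite empiricalE (eq_bigr (fun=> 1)) => [|k _].
    by rewrite sumr_const card_ord mulVf// pnatr_eq0.
  rewrite mem_set//; elim: (k : nat) => // i ih; apply: fX.
  by exists (iter i f y).
- move=> E _; change (@empirical R T f y n (f @^-1` E) = @empirical R T f y n
  E).
  rewrite !empiricalE; congr (_ * _)%:E.
  rewrite big_ord_recr/= [RHS]big_ord_recl/= addrC; congr (_ + _).
    by rewrite -[in RHS]yp /=.
- move=> E _ fE; have Ek k : (iter k f y \in E) = (y \in E).
    elim: k => // k ih; rewrite -ih -[in RHS]fE.
    by apply/idP/idP; rewrite !inE.
  change (@empirical R T f y n E = 0%E \/ @empirical R T f y n E = 1%E).
  rewrite empiricalE (eq_bigr (fun=> (y \in E)%:R)) => [|k _];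
    last by rewrite Ek.
  rewrite sumr_const card_ord; case: (_ \in _); [right|left].
    by rewrite mulVf// pnatr_eq0.
  by rewrite mul0rn mulr0.
Qed.

Lemma ultra_cvg01 (I : Type) (U : set_system I) (h : I -> R) : UltraFilter U ->
  (forall i, 0 <= h i <= 1) -> exists l : R, 0 <= l /\ h @ U --> l.
Proof.
move=> UU h01; have [] := @segment_compact R 0 1 (h @ U) _.
  change (U (h @^-1` [set` `[0, 1]])).
  by apply: filterS (@filterT _ U _) => i _; rewrite /preimage/= in_itv/= h01.
move=> l [l01 cl]; exists l; split; first by move: l01;
  rewrite /= in_itv/= => /andP[].
move=> V Vl; have [//|nV] := in_ultra_setVsetC (h @^-1` V) UU.
have [z [Az Vz]] := cl (~` V) V nV Vl.
by exfalso; exact: Az Vz.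
Qed.

(** Ultrafilter limits exist on each finite-dimensional set and are finitely additive there, so they
    extend to a Borel measure. *)
Lemma ultra_limit_measure (I : Type) (U : set_system I)
    (nu : I -> probability (borel T) R) : UltraFilter U ->
  exists mu : probability (borel T) R, forall C, fin_dim C ->
    (fun i => fine (nu i C)) @ U --> fine (mu C).
Proof.
move=> UU; have /choice[c hc] C : exists l : R, 0 <= l /\
    (fin_dim C -> (fun i => fine (nu i C)) @ U --> l).
  have [fC|nC] := pselect (fin_dim C); last by exists 0.
  have mC := measurable_fin_dim fC.
  have [|l [l0 hl]] := @ultra_cvg01 I U (fun i => fine (nu i C)) UU.
    move=> i; rewrite fine_ge0//= -lee_fin fineK ?fin_num_measure//.
    exact: probability_le1.
  by exists l.
have cE C l : fin_dim C -> (fun i => fine (nu i C)) @ U --> l -> c C = l.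
  by move=> fC; apply: cvg_unique; [exact: Rhausdorff|exact: (hc C).2].
have [||mu muE] := @ex_fin_dim_probability R B c (fun C => (hc C).1).
- apply: (cE _ _ (@fin_dimT R B)).
  under eq_fun do rewrite probability_setT; exact: cvg_cst.
- move=> C D fC fD CD; apply: cE; first exact: fin_dimU.
  have -> : (fun i => fine (nu i (C `|` D))) =
      (fun i => fine (nu i C) + fine (nu i D)).
    apply/funext => i; have mC := measurable_fin_dim fC.
    have mD := measurable_fin_dim fD.
    by rewrite measureU// fineD// fin_num_measure.
  by apply: cvgD; [exact: (hc C).2|exact: (hc D).2].
by exists mu => C fC; rewrite muE//; exact: (hc C).2.
Qed.

(** Along an ultrafilter refining [\oo], the empirical measures of x and of the approximating points
    have the same limit. The former make it an accumulation point, the latter put it in the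
    closure. *)
Lemma limit_measures_closure x (M0 : set (weak_star R T)) :
  (forall N, exists n y, [/\ (N <= n)%N, agree n.+1 x y &
     M0 (@empirical R T f y n)]) ->
  limit_measures f x `&` closure M0 !=set0.
Proof.
move=> /choice[n /choice[y hny]].
have [U [UU subU]] := ultraFilterLemma (@eventually_filter).
have [mu hmu] := ultra_limit_measure (fun N => @empirical R T f x (n N)) UU.
have cvg1 : (fun N => @empirical R T f x (n N) : weak_star R T) @ U --> (mu :
  weak_star R T).
  by apply: weak_star_fin_dim_cvg => C fC; exact: hmu.
have cvg2 : (fun N => @empirical R T f (y N) (n N) :
  weak_star R T) @ U --> (mu : weak_star R T).
  apply: weak_star_fin_dim_cvg => C fC; apply/cvgrPdist_le => e e0.
  have [m mC] := fC; have e20 : 0 < e / 2 by rewrite divr_gt0.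
  have /cvgrPdist_le/(_ _ e20) h1 := hmu C fC.
  have h2 : U [set N | m%:R / (n N).+1%:R <= e / 2].
    apply: subU; exists (Num.bound (m%:R / (e / 2))) => // N /= bN.
    rewrite ler_pdivrMr// mulrC -ler_pdivrMr//.
    apply: le_trans (ltW (archi_boundP _)) _; first by rewrite divr_ge0// ltW.
    by rewrite ler_nat; have [Nn _ _] := hny N; exact: leq_trans bN (leqW Nn).
  suff : U [set N | `|fine (mu C) - fine (@empirical R T f (y N) (n N) C)| <=
    e] by [].
  apply: filterS (filterI h1 h2) => N [/= h3 h4].
  have [_ xy _] := hny N; have h5 := empirical_agree mC xy.
  rewrite [leRHS]splitr; apply: le_trans (lerD h3 (le_trans h5 h4)).
  by apply: le_trans (ler_normD _ _); rewrite subrKA.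
exists (mu : weak_star R T); split.
  move=> A V FA Vmu.
  have U1 : U [set N | V (@empirical R T f x (n N))] := cvg1 _ Vmu.
  have U2 : U [set N | A (@empirical R T f x (n N))].
    case: FA => N0 _ hN0; apply: subU; exists N0 => // N /= NN.
    by apply: hN0 => /=; apply: leq_trans NN _; have [] := hny N.
  have [N [AN VN]] := filter_ex (filterI U2 U1).
  by exists (@empirical R T f x (n N) : weak_star R T).
move=> V Vmu.
have [N VN] : exists N, V (@empirical R T f (y N) (n N)).
  exact: (@filter_ex _ U _ _ (cvg2 _ Vmu)).
by exists (@empirical R T f (y N) (n N) : weak_star R T); split => //;
  have [] := hny N.
Qed.

End empirical_measures.

(** * Measures that are not carried by Z *)

Lemma closure_le (R : realType) (T : topologicalType) (F : T -> R)
    (S : set T) c :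
  continuous F -> (forall x, S x -> F x <= c) ->
  forall x, closure S x -> F x <= c.
Proof.
move=> cF SF x Sx; have /closure_id cl : closed (F @^-1` [set y | y <= c]).
  by apply: preimage_closed; [move=> ? _; exact: cF|exact: closed_le].
suff : closure (F @^-1` [set y | y <= c]) x by rewrite -cl.
by move: x Sx; apply: closureS.
Qed.

(** The finite-dimensional sets form a generating pi-system, so mu equals its push-forward. *)
Lemma shift_invariant_fin_dim (R : realType) (B : alphabetType)
    (mu : probability (borel (fullshift R B)) R) :
  (forall C, fin_dim C -> mu (@shift_map R B @^-1` C) = mu C) ->
  shift_invariant mu.
Proof.
move=> muf E mE; have mf : measurable_fun setT
    (@shift_map R B : borel (fullshift R B) -> borel (fullshift R B)).
  by move=> _ D mD; rewrite setTI; exact: measurable_preimage_shift.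
pose nu : {measure set (borel (fullshift R B)) -> \bar R} :=
  pushforward mu (@shift_map R B : borel (fullshift R B) ->
    borel (fullshift R B)).
have H := @measure_unique _ R (borel (fullshift R B)) (@fin_dim R B)
  (fun=> setT) (measurable_fin_dimE B) (@fin_dimI R B) (fun=> @fin_dimT R B)
  _ (nu mf) mu muf.
apply: H => //; first by rewrite bigcup_const//; exists 0%N.
by move=> _; rewrite /= /pushforward preimage_setT probability_setT ltry.
Qed.

Section non_recoded_measures.
Context {R : realType} (A : finType) (Z : set (fullshift R A)) (g : nat -> nat).
Variable t : R.
Hypotheses (subZ : subshift Z) (t_gt0 : 0 < t).
Hypothesis (tg : forall n, t * n%:R <= (g n)%:R).
Local Notation T := (fullshift R (option A)).
Local Notation f := (@shift_map R (option A)).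
Local Notation X := (gap_shift Z g).
Local Notation ZB := (recode Some @` Z).

Definition gap_measures : set (weak_star R T) :=
  ergodic_measures f X `\` ergodic_measures f ZB.

Lemma ergodic_gap_shift :
  ergodic_measures f X = gap_measures `|` ergodic_measures f ZB.
Proof.
apply/seteqP; split => mu; last first.
  case=> [[]//|[muZ inv erg]]; split=> //; apply/eqP.
  rewrite eq_le probability_le1/=; last first.
    exact: measurable_closed (@closed_gap_shift R A Z g).
  rewrite -muZ; apply: le_measure; rewrite ?inE.
  - exact: measurable_closed (closed_recode g subZ).
  - exact: measurable_closed (@closed_gap_shift R A Z g).
  - exact: subset_gap_shift.
by move=> muX; have [?|?] := pselect (ergodic_measures f ZB mu); [right|left].
Qed.

(** ZB is forward invariant, so its preimages increase to an invariant set of the same mass. By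
    ergodicity the mass is 0 or 1, and 1 would make mu ergodic on ZB. *)
Lemma gap_measures_null (mu : probability (borel T) R) :
  gap_measures mu -> mu ZB = 0%E.
Proof.
move=> [[muX inv erg] nZ]; have mZ : measurable (ZB : set (borel T)).
  exact: measurable_closed (closed_recode g subZ).
pose E i : set (borel T) := iter i f @^-1` ZB.
have mE i : measurable (E i) by exact: measurable_preimage_iter.
have muE i : mu (E i) = mu ZB by exact: invariant_iter.
have mU : measurable (\bigcup_i E i) by exact: bigcupT_measurable.
have ES i : E i `<=` E i.+1 by move=> x /(recode_shift subZ).
have fE : f @^-1` (\bigcup_i E i) = \bigcup_i E i.
  apply/seteqP; split=> x [i _ Ex].
    by exists i.+1 => //; rewrite /E/= -iterS iterSr.
  by exists i => //; have := ES _ _ Ex; rewrite /E/= -iterS iterSr.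
have Z0 : ~ mu ZB = 1%E by move=> Z1; apply: nZ.
suff cvgE : mu (\bigcup_i E i) = mu ZB.
  by rewrite -cvgE; have [//|] := erg _ mU fE; rewrite cvgE.
have : mu \o E @ \oo --> mu (\bigcup_i E i).
  apply: nondecreasing_cvg_mu => //.
  by apply/nondecreasing_seqP => i; apply/subsetPset; exact: ES.
rewrite (_ : mu \o E = cst (mu ZB)); last by apply/funext => i; exact: muE.
by move=> /(cvg_lim (@ereal_hausdorff R)) <-; rewrite lim_cst.
Qed.

Lemma gap_measures_density (mu : probability (borel T) R) :
  gap_measures mu -> fine (mu [set x : T | x 0%N]) <= (1 + t)^-1.
Proof.
move=> M0mu; have muZ := gap_measures_null M0mu.
by case: M0mu => -[muX inv erg] _;
  exact: (letter_density subZ t_gt0 tg inv muX muZ).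
Qed.

(** Both properties are closed conditions on finite-dimensional sets, and they are all that
    separation and the entropy bound require. *)
Lemma closure_gap_measures (mu : weak_star R T) : closure gap_measures mu ->
  shift_invariant mu /\
  fine ((mu : probability (borel T) R) [set x : T | x 0%N]) <= (1 + t)^-1.
Proof.
have fA : fin_dim [set x : T | x 0%N] by exact: (fin_dim_coord 0%N isSome).
move=> cl; split; last first.
  apply: (closure_le (measure_continuous fA) _ cl) => nu.
  exact: gap_measures_density.
apply: shift_invariant_fin_dim => C fC.
have fC' := fin_dim_shift fC.
pose F (nu : weak_star R T) :=
  fine ((nu : probability (borel T) R) (f @^-1` C)) -
  fine ((nu : probability (borel T) R) C).
have cF : continuous F.
  move=> nu; exact: cvgB (@measure_continuous _ _ _ fC' nu)
    (@measure_continuous _ _ _ fC nu).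
have F0 nu : gap_measures nu -> F nu = 0.
  move=> [[_ inv _] _]; rewrite /F inv ?subrr//; exact: measurable_fin_dim.
have Fle : F mu <= 0 by apply: (closure_le cF _ cl) => nu /F0 ->.
have Fge : - F mu <= 0.
  by apply: (@closure_le R _ (- F)%R _ _ _ _ _ cl) => [nu|nu /F0 Fnu];
    [exact: (cvgN (cF nu))|rewrite fctE Fnu oppr0].
have : F mu = 0 by apply/eqP; rewrite eq_le Fle -oppr_le0.
rewrite /F => /eqP; rewrite subr_eq0 => /eqP E.
rewrite -[LHS]fineK ?fin_num_measure//; last exact: measurable_fin_dim.
by rewrite E fineK// fin_num_measure//; exact: measurable_fin_dim.
Qed.

(** Limits of measures on ZB give mass 1 to a letter at coordinate 0, while the other family gives
    at most (1 + t)^-1 < 1. *)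
Lemma closure_gap_measures_disjoint :
  closure gap_measures `&` closure (ergodic_measures f ZB) = set0.
Proof.
rewrite -subset0 => mu [/closure_gap_measures[_ le1] cl].
have fA : fin_dim [set x : T | x 0%N] by exact: (fin_dim_coord 0%N isSome).
have c1 : continuous (fun nu : weak_star R T =>
    - fine ((nu : probability (borel T) R) [set x : T | x 0%N])).
  by move=> nu; exact: (cvgN (@measure_continuous _ _ _ fA nu)).
have : - fine ((mu : probability (borel T) R) [set x : T | x 0%N]) <= - 1.
  apply: (closure_le c1 _ cl) => nu [nuZ _ _]; rewrite lerN2 -lee_fin fineK;
    last first.
    by rewrite fin_num_measure//; exact: measurable_fin_dim.
  rewrite -nuZ; apply: le_measure; rewrite ?inE.
  - exact: measurable_closed (closed_recode g subZ).
  - exact: measurable_fin_dim.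
  - by move=> _ [z _ <-].
have : (1 + t)^-1 < 1 by rewrite invf_lt1 ?ltrDl ?addr_gt0.
move: le1; move: (fine _) ((1 + t)^-1) => a b; lra.
Qed.

Lemma entropy_gap_measures (mu : weak_star R T) : closure gap_measures mu ->
  (entropy f (mu : probability (borel T) R)
    <= (ln 2 + (1 + t)^-1 * ln #|A|%:R)%:E)%E.
Proof.
move=> /closure_gap_measures[inv muA].
have A0 : (0 < #|A|)%N.
  by have [[z _] _ _] := subZ; apply/card_gt0P; exists (z 0%N).
have A0R : (0 : R) < #|A|%:R by rewrite ltr0n.
(* Half of the weight goes to the star and half is shared equally by the letters. *)
pose q (b : option A) : R := if b is Some _ then 2^-1 / #|A|%:R else 2^-1.
have q0 b : 0 < q b by case: b => [a|]; rewrite /q ?divr_gt0 ?invr_gt0.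
have q1 : \sum_b q b <= 1.
  rewrite (bigD1 None)//= (eq_bigr (fun=> 2^-1 / #|A|%:R)); last by case.
  rewrite sumr_const cardC1 card_option/= -[_ *+ #|A|]mulr_natl.
  rewrite mulrC divfK ?gt_eqF//.
  lra.
apply: le_trans (entropy_le inv q0 q1) _; rewrite lee_fin /coord_cost.
have mW : finite_valued (fun x : borel T => (x : T) 0%N).
  exact: finite_valued_coord.
have qE b : - ln (q b) = ln 2 + (b : bool)%:R * ln #|A|%:R.
  case: b => [a|]; rewrite /q /=.
    by rewrite lnM ?posrE ?invr_gt0// !lnV ?posrE// opprD !opprK mul1r.
  by rewrite lnV ?posrE// opprK mul0r addr0.
under eq_bigr do rewrite qE mulrDr mulrA.
rewrite big_split/= -!mulr_suml sum_law// mul1r lerD2l ler_wpM2r//.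
  by rewrite ln_ge0// ler1n.
apply: le_trans muA; rewrite le_eqVlt; apply/orP; left; apply/eqP.
rewrite (law_pred mu isSome mW) [RHS]big_mkcond/=; apply: eq_bigr => b _.
by case: b => [a|]; rewrite ?mulr1 ?mulr0.
Qed.

Lemma limit_gap_measures x : {homo g : m n / (m <= n)%N} ->
  (X `\` \bigcup_i (iter i f @^-1` ZB)) x ->
  limit_measures f x `&` closure gap_measures !=set0.
Proof.
move=> g_nd Xx; apply: limit_measures_closure => N.
have [p [y [Np Xy yp xy yp1]]] :=
  frequent_periodic subZ g_nd Xx.1 (frequent_star subZ Xx) N.
have pE : p.-1.+1 = p by lia.
exists p.-1, y; rewrite pE; split => //; first by lia.
split.
  apply: ergodic_periodic => //; first exact: closed_gap_shift.
    by have [] := subshift_gap_shift g subZ.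
  by rewrite pE; exact: iter_periodic.
move=> [muZ _ _]; have : [set x : T | x p.-1] y; last by rewrite /= yp1.
pose E : set T := [set x : T | forall k, x k].
move: muZ; change (@empirical R T f y p.-1 ZB = 1%E -> isSome (y p.-1)).
rewrite empiricalE => -[] /eqP; rewrite (eq_bigr (fun=> 0)).
  by rewrite sumr_const mul0rn mulr0 eq_sym oner_eq0.
move=> k _; rewrite memNset// => -[z _ zy].
(* The star at p.-1 recurs with period p; its copy at p.-1 + p * k lies beyond k, so no point of the
   orbit is in ZB. *)
have := congr1 (fun u : T => u (p.-1 + p * k - k)%N) zy.
rewrite iter_shift_mapE /recode /=.
suff -> : y (k + (p.-1 + p * k - k))%N = None by [].
by rewrite -yp1 mulnC subnKC ?periodicMn//; nia.
Qed.

End non_recoded_measures.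

(** * The choice of g *)

Lemma le_limn_einf (R : realType) (u v : (\bar R)^nat) :
  (forall n, u n <= v n)%E -> (limn_einf u <= limn_einf v)%E.
Proof.
move=> uv; rewrite !limn_einf_lim; apply: lee_lim; [exact: is_cvg_einfs..|].
apply: nearW => n; apply: le_ereal_inf_tmp => _ [k /= nk <-].
by apply: le_trans (uv k); apply: ereal_inf_lbound; exists k.
Qed.

(** The constants c and c' leave room for the window in [gap_shift_gap]. *)
Lemma exists_gap (R : realType) (tau : \bar R) (delta : R) :
  (0 < tau)%E -> 0 < delta ->
  exists (g : nat -> nat) (t : R),
    [/\ {homo g : m n / (m <= n)%N}, forall n, (0 < n)%N -> (0 < g n)%N,
        0 < t & forall n, t * n%:R <= (g n)%:R] /\
    [/\ forall c c', (fun n => ((c' + g (n + c))%N%:R / n%:R)%:E) @ \oo --> tau,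
        forall r, tau = r%:E -> t = r & tau = +oo%E -> (1 + t)^-1 <= delta].
Proof.
case: tau => [t| |]; rewrite ?lte_fin// => t0 d0.
  (* For finite tau, rounding t n up keeps t n <= g n at the optimal slope t = tau. *)
  exists (fun n => (Num.truncn (t * n%:R)).+1), t.
  have tn0 n : 0 <= t * n%:R by rewrite mulr_ge0// ltW.
  split; split=> //.
  - by move=> m n mn; rewrite ltnS; apply: le_truncn;
    rewrite ler_pM2l// ler_nat.
  - by move=> n; apply/ltW/truncnS_gt.
  - move=> c c'; apply: cvg_EFin; first by apply: nearW.
    pose K := c'%:R + t * c%:R + 1.
    apply: (@squeeze_cvgr _ _ _ _ (fun=> t) (fun n => t + K * n%:R^-1)).
    + exists 1%N => // n /= n0.
      have n0R : (0 : R) < n%:R by rewrite ltr0n.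
      rewrite /= ler_pdivlMr// ler_pdivrMr// mulrDl divfK ?gt_eqF//.
      have := truncn_itv (tn0 (n + c)%N); rewrite natrD mulrDr => /andP[h1 h2].
      have := tn0 c; have : (0 : R) <= c'%:R by [].
      move: h1 h2; rewrite -!natr1 natrD -natr1 => h1 h2 h3 h4.
      by apply/andP; split; rewrite /K; lra.
    + exact: cvg_cst.
    + rewrite -[X in _ --> X]addr0 -[X in _ + X](mulr0 K).
      apply: cvgD; first exact: cvg_cst.
      apply: cvgMr; apply/gtr0_cvgV0; last exact: cvgr_idn.
      by exists 1%N => // n /= n0; rewrite ltr0n.
  - by move=> r [].
(* For infinite tau the linear part k n, with k >= 1 / delta, gives the density bound, and the
   quadratic part makes the rate infinite. *)
pose k := (Num.bound (delta^-1)).+1.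
exists (fun n => (k * n + n * n)%N), k%:R; split; split=> //.
- by move=> m n mn; rewrite leq_add// leq_mul.
- by move=> n n0; rewrite addn_gt0 muln_gt0 n0.
- by move=> n; rewrite -natrM ler_nat leq_addr.
- move=> c c'; apply/cvgeyPge => M.
  exists (maxn 1 (Num.bound `|M|)) => // n /=; rewrite geq_max => /andP[n0 Mn].
  have n0R : (0 : R) < n%:R by rewrite ltr0n.
  rewrite lee_fin ler_pdivlMr//; apply: (@le_trans _ _ (n%:R * n%:R)).
    rewrite ler_pM2r//; apply: (@le_trans _ _ (Num.bound `|M|)%:R);
      last by rewrite ler_nat.
    by apply: le_trans (ler_norm M) (ltW (archi_boundP _)).
  by rewrite -natrM ler_nat; nia.
- move=> _; rewrite -[leRHS]invrK lef_pV2 ?posrE ?invr_gt0 ?addr_gt0//.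
  apply: le_trans (ltW (archi_boundP _)) _; first by rewrite invr_ge0 ltW.
  by rewrite addrC natr1 ler_nat /k; lia.
Qed.

(** * The optimal rate of the gap shift *)

Section rate.
Context {R : realType} (A : finType) (Z : set (fullshift R A)) (g : nat -> nat).
Hypotheses (subZ : subshift Z) (g_nd : {homo g : m n / (m <= n)%N}).
Hypothesis (g_gt0 : forall n, (0 < n)%N -> (0 < g n)%N).
Variable tau : \bar R.
Hypothesis g_tau : forall c c',
  (fun n => ((c' + g (n + c))%N%:R / n%:R)%:E : \bar R) @ \oo --> tau.
Local Notation f := (@shift_map R (option A)).
Local Notation X := (gap_shift Z g).

Lemma gap_shift_gap_cvg (e : R) :
  (fun n => ((gap_shift_gap g n e)%:R / n%:R)%:E) @ \oo --> tau.
Proof. exact: (g_tau (window e) (window e).+1). Qed.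

(** The constructed gap function has rate tau at every scale; any other one dominates [g] at scale
    1/2, and [g] already has rate tau. *)
Lemma periodic_specification_gap_shift : periodic_specification X f tau.
Proof.
split.
  exists (gap_shift_gap g); first exact: gap_function_gap_shift.
  rewrite /gap_rate (_ : image _ _ = [set tau]) ?ereal_sup1//.
  apply/seteqP; split=> [_ [e /= e0 <-]|_ ->] /=.
    by have [->] := cvg_limn_einf_sup (gap_shift_gap_cvg e).
  exists 1 => //=; by have [->] := cvg_limn_einf_sup (gap_shift_gap_cvg 1).
move=> M gM; apply: (@le_trans _ _ (limn_einf
    (fun n => ((M n 2^-1)%:R / n%:R)%:E))); last first.
  by apply: ereal_sup_ubound; exists 2^-1 => //=; rewrite invr_gt0.
have gt : (fun n => ((g n)%:R / n%:R)%:E : \bar R) @ \oo --> tau.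
  by have := g_tau 0 0; under eq_fun do rewrite addn0 add0n.
have [<- _] := cvg_limn_einf_sup gt; apply: le_limn_einf => -[|n].
  (* At n = 0 both quotients are 0, since the inverse of 0 is 0. *)
  by rewrite invr0 !mulr0.
rewrite lee_fin ler_pM2r ?invr_gt0// ler_nat.
by apply: (gap_function_ge subZ g_nd gM) => //;
  rewrite ?invr_gt0// invf_lt1// ltr1n.
Qed.

End rate.

Theorem theorem2 (R : realType) (tau : \bar R) (A : finType)
    (Z : set (fullshift R A)) (delta : R) :
  (0 < tau)%E -> subshift Z -> 0 < delta ->
  exists (B : alphabetType) (iota : A -> B) (X : set (fullshift R B))
      (M : nat -> R -> nat) (M0 : set (weak_star R (fullshift R B))),
    let f := @shift_map R B in
    let ZB := recode iota @` Z in
    [/\ injective iota, subshift X & dynamical_system X f] /\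
    [/\ periodic_specification X f tau,
        gap_function X f M &
        \forall e \near 0^'+,
          (fun n => ((M n e)%:R / n%:R)%:E) @ \oo --> tau] /\
    ZB `<=` X /\
    (ergodic_measures f X = M0 `|` ergodic_measures f ZB /\
     closure M0 `&` closure (ergodic_measures f ZB) = set0) /\
    (forall x, (X `\` \bigcup_i (iter i f @^-1` ZB)) x ->
       limit_measures f x `&` closure M0 !=set0) /\
    (forall t : R, tau = t%:E ->
       forall mu, closure M0 mu ->
         (entropy f mu <= (ln 2 + (1 + t)^-1 * ln #|A|%:R)%:E)%E) /\
    (tau = +oo%E ->
       forall mu, closure M0 mu ->
         (entropy f mu <= (ln 2 + delta * ln #|A|%:R)%:E)%E).
Proof.
move=> tau0 subZ delta0.
have [g [t [[g_nd g_gt0 t0 tg] [g_tau t_fin t_oo]]]] := exists_gap tau0 delta0.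
exists (option A), Some, (gap_shift Z g), (gap_shift_gap g), (gap_measures Z g).
move=> f ZB; split; [|split; [|split; [|split; [|split; [|split]]]]].
- split; [exact: Some_inj|exact: subshift_gap_shift|].
  exact: dynamical_system_gap_shift.
- split; first exact: periodic_specification_gap_shift.
    exact: gap_function_gap_shift.
  by apply: nearW => e; exact: gap_shift_gap_cvg.
- exact: subset_gap_shift.
- split; first exact: ergodic_gap_shift.
  exact: (closure_gap_measures_disjoint subZ t0 tg).
- by move=> x; exact: limit_gap_measures.
- by move=> r /t_fin <- mu; exact: entropy_gap_measures.
- move=> /t_oo tdelta mu /(entropy_gap_measures subZ t0 tg) h;
  apply: le_trans h _.
  have [[z _] _ _] := subZ.
  rewrite lee_fin lerD2l ler_wpM2r// ln_ge0// ler1n.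
  by apply/card_gt0P; exists (z 0%N).
Qed.
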